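(* Let $\mathcal F$ be a minor-closed family of finite graphs which does not contain all finite graphs. Then there is a constant $c_{\mathcal F}>0$ such that for every $G\in\mathcal F$ with $n$ vertices and maximum degree $d_{\max}$, and every $1\le k\le n$, $$\lambda_k(G) \le c_{\mathcal F}\, d_{\max}\,\frac{k}{n},$$ where $\lambda_k(G)$ is the $k$-th smallest eigenvalue of the Laplacian of $G$.
   Context: For a finite undirected graph $G=(V,E)$ the Laplacian is $\mathcal L=D-A$ ($A$ adjacency matrix, $D$ diagonal degree matrix); eigenvalues are counted with multiplicity in nondecreasing order, $\lambda_1(G)\le\lambda_2(G)\le\cdots$. A graph $H$ is a minor of $G$ if it can be obtained from $G$ by a sequence of edge contractions and vertex deletions; a family $\mathcal F$ is minor-closed if $G\in\mathcal F$ and $H$ a minor of $G$ imply $H\in\mathcal F$.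
   Formalization: Minors are taken in the standard sense, with edge deletions allowed besides edge contractions and vertex deletions; without edge deletions the claim fails for the family of complete graphs, where λ_2(K_n) = n. *)

(* Defs.v *)
From HB Require Import structures.
From mathcomp Require Import all_boot all_order all_algebra.
From mathcomp Require Import polyrcf.
From mathcomp Require Import reals.
Set Implicit Arguments.
Unset Strict Implicit.
Unset Printing Implicit Defensive.
Import Order.TTheory GRing.Theory Num.Theory.
Local Open Scope ring_scope.

Record graph := Graph {
  gn : nat;
  gadj : rel 'I_gn;
  gsym : symmetric gadj;
  girr : irreflexive gadj }.
Arguments gadj : clear implicits.

Definition nverts (G : graph) : nat := gn G.

Definition deg (G : graph) (v : 'I_(gn G)) : nat := #|[set w | gadj G v w]|.
Definition dmax (G : graph) : nat := (\max_(v : 'I_(gn G)) deg v)%N.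

Definition connected_in (G : graph) (B : {set 'I_(gn G)}) : Prop :=
  forall x y, x \in B -> y \in B ->
    connect [rel u v | [&& gadj G u v, u \in B & v \in B]] x y.

(* H is a minor of G (obtained by vertex deletions, edge deletions and edge
   contractions, up to isomorphism): standard branch-set model. *)
Definition minor (H G : graph) : Prop :=
  exists B : 'I_(gn H) -> {set 'I_(gn G)},
    [/\ forall i, B i != set0,
        forall i j, i != j -> [disjoint B i & B j],
        forall i, connected_in (B i) &
        forall i j, gadj H i j ->
          exists x y, [/\ x \in B i, y \in B j & gadj G x y]].

Definition minor_closed (F : graph -> Prop) : Prop :=
  forall G H, F G -> minor H G -> F H.

Definition laplacian (R : realType) (G : graph) : 'M[R]_(gn G) :=
  \matrix_(i, j) ((deg i)%:R *+ (i == j) - (gadj G i j)%:R).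

(* Eigenvalues (roots of the characteristic polynomial) counted with
   (algebraic) multiplicity, in nondecreasing order. *)
Definition lap_eigs (R : realType) (G : graph) : seq R :=
  flatten [seq nseq (mup x (char_poly (laplacian R G))) x
          | x <- rootsR (char_poly (laplacian R G))].

Definition lambda (R : realType) (G : graph) (k : nat) : R :=
  nth 0 (lap_eigs R G) k.-1.

(* Main.v *)
(* Idea (after Kelner, Lee, Price and Teng).  It suffices to find k functions with
   disjoint supports and small Rayleigh quotients.  They come from vertex weights w
   with sum of w^2 at most of order delta^2 n / r, where r ~ n / k, such that at
   least half of the vertices contain no r-subset of w-diameter delta.  To get w,
   start from w = 1 and, as long as disjoint r-sets of w-diameter delta cover half
   of the vertices, add to w the load of shortest paths joining all pairs inside
   these sets.  After T steps the sum of w^2 is at most linear in T, whereas a graph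
   without K_h minor satisfies a crossing inequality (random centres, joined by
   non-crossing two-edge walks, would form a dense minor) that makes it quadratic
   in T; so the process stops early.  The Klein-Plotkin-Rao procedure then slices the
   graph, for the metric of w, into clusters coverable by fewer than h balls of
   small radius, which hold O(h r) of the good vertices each.  The truncated
   distance to the slice boundaries, restricted to bundles of clusters, provides
   the k test functions. *)
Require Import Defs.
From HB Require Import structures.
From mathcomp Require Import all_boot all_order all_algebra.
From mathcomp Require Import polyrcf complex spectral.
From mathcomp Require Import reals zify ring.
Set Implicit Arguments.
Unset Strict Implicit.
Unset Printing Implicit Defensive.
Import Order.TTheory GRing.Theory Num.Theory.

(** * Branch sets and dense minors *)

(** Weights sit on vertices, not edges, because the degree may enter only linearly: in the main case
    it appears once, when the energy of the test functions is bounded by a constant times [d_max]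
    times the sum of w^2. A good w would usually come from duality between metrics and flows; here
    the iteration plays that role. T steps along paths of weight at most delta give a sum of w^2 of
    order n r delta T, while congestion demands order n r^3 T^2. These balance at T of order delta /
    r^2, which leaves a sum of order n delta^2 / r. All of this is done in integers: delta is a
    large multiple of r^2, so that T is an integer and the squares of single loads are negligible.
    Expectations are sums over all colourings with denominators cleared. The obstacle in the
    crossing inequality is that paths may share vertices and ends freely; random centres make
    crossings and repeated pairs of centres rare enough to be deleted. If n is below a constant
    times k, then r would be too small, and point masses are used instead. *)

Section Minors.
Context (V : finType) (e : rel V) (e_sym : symmetric e).

Definition within (B : {set V}) : rel V := [rel u v | [&& e u v, u \in B & v \in B]].

Definition conn (B : {set V}) : bool :=
  [forall x in B, forall y in B, connect (within B) x y].

Definition touch (A B : {set V}) : bool := [exists x in A, exists y in B, e x y].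

Lemma connP (B : {set V}) : reflect {in B &, forall x y, connect (within B) x y} (conn B).
Proof.
apply: (iffP forall_inP) => [H x y xB yB|H x xB]; first exact: (forall_inP (H x xB)).
by apply/forall_inP => y yB; apply: H.
Qed.

Lemma touchP (A B : {set V}) : reflect (exists x y, [/\ x \in A, y \in B & e x y]) (touch A B).
Proof.
apply: (iffP exists_inP) => [[x xA /exists_inP[y yB exy]]|[x [y [xA yB exy]]]].
  by exists x, y.
by exists x => //; apply/exists_inP; exists y.
Qed.

Lemma touchC (A B : {set V}) : touch A B = touch B A.
Proof. by apply/touchP/touchP => -[x [y [xA yB xy]]]; exists y, x; rewrite e_sym. Qed.

Lemma touchS (A A' B B' : {set V}) : A \subset A' -> B \subset B' -> touch A B -> touch A' B'.
Proof.
move=> /subsetP sA /subsetP sB /touchP[x [y [xA yB xy]]].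
by apply/touchP; exists x, y; split; auto.
Qed.

Lemma touchUl (A B C : {set V}) : touch (A :|: B) C = touch A C || touch B C.
Proof.
apply/idP/orP => [/touchP[x [y [/setUP[xA|xB] yC xy]]]|[]].
- by left; apply/touchP; exists x, y.
- by right; apply/touchP; exists x, y.
- by apply: touchS; rewrite ?subsetUl.
- by apply: touchS; rewrite ?subsetUr.
Qed.

Lemma within_sym B : symmetric (within B).
Proof. by move=> x y; rewrite /within /= e_sym; case: (x \in B); case: (y \in B); rewrite ?andbF. Qed.

Lemma connect_within_sym B : connect_sym (within B).
Proof. exact: sym_connect_sym (within_sym B). Qed.

Lemma connect_withinS (A B : {set V}) x y :
  A \subset B -> connect (within A) x y -> connect (within B) x y.
Proof.
move=> /subsetP AB; apply: connect_sub => u v /and3P[uv uA vA].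
by apply: connect1; rewrite /within /= uv !AB.
Qed.

Lemma conn_from z (B : {set V}) : (forall x, x \in B -> connect (within B) z x) -> conn B.
Proof.
move=> H; apply/connP => x y xB yB.
by apply: connect_trans (H y yB); rewrite connect_within_sym; apply: H.
Qed.

Lemma conn1 x : conn [set x].
Proof. by apply/connP => y z /set1P-> /set1P->; apply: connect0. Qed.

Lemma connU (A B : {set V}) : conn A -> conn B -> ~~ [disjoint A & B] -> conn (A :|: B).
Proof.
move=> /connP cA /connP cB /pred0Pn[z /andP[/= zA zB]].
apply: (@conn_from z) => x /setUP[xA|xB].
  by apply: connect_withinS (cA _ _ zA xA); apply: subsetUl.
by apply: connect_withinS (cB _ _ zB xB); apply: subsetUr.
Qed.

Lemma connU_touch (A B : {set V}) : conn A -> conn B -> touch A B -> conn (A :|: B).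
Proof.
move=> /connP cA /connP cB /touchP[z [w [zA wB zw]]].
apply: (@conn_from z) => x /setUP[xA|xB].
  by apply: connect_withinS (cA _ _ zA xA); apply: subsetUl.
apply: connect_trans (connect_withinS (subsetUr _ _) (cB _ _ wB xB)).
by apply: connect1; rewrite /within /= zw !inE zA wB orbT.
Qed.

Lemma conn_bigcup (I : finType) (P : {pred I}) (F : I -> {set V}) z :
  {in P, forall i, conn (F i) /\ z \in F i} -> conn (\bigcup_(i in P) F i).
Proof.
move=> H; apply: (@conn_from z) => x /bigcupP[i iP xF].
have [/connP cF zF] := H i iP.
by apply: connect_withinS (cF _ _ zF xF); apply: bigcup_sup.
Qed.

Definition clique_minor (h : nat) : Prop :=
  exists B : 'I_h -> {set V},
    [/\ forall i, B i != set0, forall i j, i != j -> [disjoint B i & B j],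
        forall i, conn (B i) & forall i j, i != j -> touch (B i) (B j)].

Definition branch_family (FB : {set {set V}}) : Prop :=
  trivIset FB /\ {in FB, forall B, conn B /\ B != set0}.

Definition adjF (B C : {set V}) : bool := (B != C) && touch B C.

Definition nadj (FB : {set {set V}}) : nat := \sum_(B in FB) \sum_(C in FB) adjF B C.

Lemma adjFC B C : adjF B C = adjF C B.
Proof. by rewrite /adjF eq_sym touchC. Qed.

Lemma nadj_add X (S : {set {set V}}) : X \notin S ->
  nadj (X |: S) = nadj S + 2 * \sum_(D in S) adjF X D.
Proof.
move=> XS; rewrite /nadj big_setU1 //= big_setU1 //= {1}/adjF eqxx add0n.
under [X in _ + X]eq_bigr => B BS do rewrite big_setU1 //= adjFC.
by rewrite big_split /= mul2n -addnn addnA addnC.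
Qed.

Lemma branch_familyS (FB FC : {set {set V}}) :
  FB \subset FC -> branch_family FC -> branch_family FB.
Proof.
move=> sub [tr cn]; split; first exact: trivIsetS sub tr.
by move=> B /(subsetP sub); apply: cn.
Qed.

Lemma branch_family_contract (S : {set {set V}}) B C :
  branch_family (B |: (C |: S)) -> B != C -> touch B C ->
  B \notin S -> C \notin S ->
  [/\ branch_family ((B :|: C) |: S), (B :|: C) \notin S &
      forall D, D \in S -> B :|: C != D].
Proof.
move=> [/trivIsetP tr cn] BC tBC BS CS.
have [cB B0] : conn B /\ B != set0 by apply: cn; rewrite !inE eqxx.
have [cC C0] : conn C /\ C != set0 by apply: cn; rewrite !inE eqxx orbT.
have dB D : D \in S -> [disjoint B & D].
  move=> DS; apply: tr; rewrite ?inE ?eqxx ?DS ?orbT //.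
  by apply: contraNneq BS => ->.
have dC D : D \in S -> [disjoint C & D].
  move=> DS; apply: tr; rewrite ?inE ?eqxx ?DS ?orbT //.
  by apply: contraNneq CS => ->.
have nBC D : D \in S -> B :|: C != D.
  move=> DS; apply: contraNneq B0 => BCD; have := dB D DS.
  by rewrite -BCD disjoint_sym -setI_eq0 setIUl setIid setU_eq0 => /andP[].
split=> //; last by apply/negP => /nBC; rewrite eqxx.
split=> [|D /setU1P[->|DS]]; last 2 first.
- by split; [apply: connU_touch | apply: contraNneq B0 => BC0; rewrite -subset0 -BC0 subsetUl].
- by apply: cn; rewrite !inE DS !orbT.
apply/trivIsetP => X Y /setU1P[->|XS] /setU1P[->|YS] XY; first by rewrite eqxx in XY.
- by rewrite -setI_eq0 setIUl setU_eq0 !setI_eq0 dB // dC.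
- by rewrite disjoint_sym -setI_eq0 setIUl setU_eq0 !setI_eq0 dB // dC.
- by apply: tr => //; rewrite !inE ?XS ?YS !orbT.
Qed.

(** Strengthened for the induction in [mader]: when [FB] consists of neighbours of a further branch
    set [B], containing a member of [FB] makes each new set touch [B], and lying in [cover FB] keeps
    it disjoint from [B]. *)
Definition clique_minor_over (FB : {set {set V}}) (h : nat) : Prop :=
  exists B : 'I_h -> {set V},
    [/\ forall i, exists2 C, C \in FB & C \subset B i,
        forall i, B i \subset cover FB,
        forall i j, i != j -> [disjoint B i & B j],
        forall i, conn (B i) & forall i j, i != j -> touch (B i) (B j)].

(* Mader's argument.  Contracting a pair with fewer than 2^h common neighbours
   keeps the density; if there is no such pair, the neighbourhood of a branch
   set is itself dense for h - 1. *)
Lemma mader (h : nat) (FB : {set {set V}}) :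
  branch_family FB -> FB != set0 -> 2 ^ h.+1 * #|FB| <= nadj FB ->
  clique_minor_over FB h.
Proof.
elim: h FB => [|h IHh] FB; first by move=> *; exists (fun=> set0); split=> - [].
have [n] := ubnP #|FB|; elim: n FB => // n IHn FB /ltnSE-FBn bFB FB0 cFB.
pose common B C := \sum_(D in FB :\ B :\ C) (adjF B D && adjF C D).
have [/exists_inP[B BFB /exists_inP[C CFB /andP[adjBC few]]]|many] :=
  boolP [exists B in FB, exists C in FB, adjF B C && (common B C < 2 ^ h.+1)].
  have /andP[BC tBC] := adjBC.
  set S := FB :\ B :\ C; have BS : B \notin S by rewrite !inE eqxx andbF.
  have CS : C \notin S by rewrite !inE eqxx.
  have FBE : FB = B |: (C |: S).
    by rewrite setD1K ?setD1K // !inE eq_sym BC.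
  have BCS : B \notin C |: S by rewrite in_setU1 negb_or BC.
  have [bF' nBC neBC] : [/\ branch_family ((B :|: C) |: S), (B :|: C) \notin S &
      forall D, D \in S -> B :|: C != D].
    by apply: branch_family_contract => //; rewrite -FBE.
  have cardE : #|FB| = #|S|.+2 by rewrite FBE !cardsU1 BCS CS.
  have [] := IHn ((B :|: C) |: S) => //.
  - by move: FBn; rewrite cardsU1 nBC cardE; clear; lia.
  - by apply/set0Pn; exists (B :|: C); rewrite !inE eqxx.
  - move: cFB; rewrite cardE {1}FBE !nadj_add // cardsU1 nBC.
    rewrite big_setU1 //= adjBC.
    (* Merging [B] and [C] destroys their own edge and one edge per common neighbour: at most
       [2 ^ h.+1] edges, or [2 ^ h.+2] ordered pairs, which is the quota of the one branch set that
       is lost. *)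
    have : \sum_(D in S) adjF B D + \sum_(D in S) adjF C D
        <= \sum_(D in S) adjF (B :|: C) D + common B C.
      rewrite -!big_split /=; apply: leq_sum => D DS.
      have -> : adjF (B :|: C) D = adjF B D || adjF C D.
        rewrite /adjF neBC // touchUl /=.
        have -> : B != D by apply: contraNneq BS => ->.
        by have -> : C != D by apply: contraNneq CS => ->.
      by case: adjF; case: adjF.
    rewrite [2 ^ h.+2]expnS; rewrite /= add1n; move: few; move: (2 ^ h.+1).
    move: (common B C) (\sum_(D in S) adjF B D) (\sum_(D in S) adjF C D).
    move: (\sum_(D in S) adjF (B :|: C) D) (nadj S) (#|S|); clear => a b c x y z.
    by move=> m few le dens; nia.
  move=> M [MF Mc Md Mcn Mt]; exists M; split=> // i.
    have [D /setU1P[->|DS] DM] := MF i.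
      by exists B => //; apply: subset_trans DM; apply: subsetUl.
    by exists D => //; rewrite FBE 2!in_setU1 DS !orbT.
  apply: subset_trans (Mc i) _; rewrite FBE /cover !bigcup_setU !big_set1.
  by rewrite setUA.
have {}many B C : B \in FB -> C \in FB -> adjF B C -> 2 ^ h.+1 <= common B C.
  move=> BF CF aBC; rewrite leqNgt; apply: contra many => few.
  by apply/exists_inP; exists B => //; apply/exists_inP; exists C; rewrite ?aBC.
have [B BF [C0 C0F aBC0]] : exists2 B, B \in FB & exists2 C, C \in FB & adjF B C.
  have n0 : 0 < nadj FB.
    by apply: leq_trans cFB; rewrite muln_gt0 expn_gt0 card_gt0.
  have [/exists_inP[B BF /exists_inP[C CF BC]]|none] :=
    boolP [exists B in FB, exists C in FB, adjF B C].
    by exists B => //; exists C.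
  move: n0; rewrite /nadj big1 // => B BF; rewrite big1 // => C CF.
  apply/eqP; rewrite eqb0; apply: contra none => BC.
  by apply/exists_inP; exists B => //; apply/exists_inP; exists C.
pose N := [set C in FB | adjF B C].
have NFB : N \subset FB by apply/subsetP => C; rewrite inE => /andP[].
have [|||M [MN Mc Md Mcn Mt]] := IHh N.
- exact: branch_familyS bFB.
- by apply/set0Pn; exists C0; rewrite inE C0F.
- rewrite mulnC -sum_nat_const; apply: leq_sum => C; rewrite inE => /andP[CF BC].
  apply: leq_trans (many B C BF CF BC) _.
  rewrite [leqRHS](eq_bigl (fun D => (D \in FB) && adjF B D)); last by move=> D; rewrite inE.
  rewrite big_mkcondr /= [leqRHS](bigID (fun D => D \in FB :\ B :\ C)) /=.
  apply: leq_trans (leq_addr _ _); rewrite /common [leqRHS](eq_bigl (mem (FB :\ B :\ C))).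
    by apply: leq_sum => D _; case: adjF.
  by move=> D; rewrite !inE; case: (D \in FB); rewrite ?andbF ?andbT.
have [trF cnF] := bFB; have [cB B0] := cnF B BF.
have BM j : [disjoint B & M j].
  apply: disjointWr (Mc j) _; rewrite disjoint_sym disjoints_subset.
  apply/bigcupsP => C; rewrite inE => /andP[CF /andP[BC _]].
  by rewrite -disjoints_subset disjoint_sym; apply: (trivIsetP trF).
have tBM j : touch B (M j).
  have [C] := MN j; rewrite inE => /andP[_ /andP[_ tBC]] CM.
  exact: touchS tBC.
exists (fun i => if unlift ord0 i is Some j then M j else B); split=> [i|i|i i' ii'|i|i i' ii'].
- case: unliftP => [j _|_]; last by exists B.
  by have [C CN CM] := MN j; exists C => //; apply: (subsetP NFB).
- case: unliftP => [j _|_]; last exact: (bigcup_sup B).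
  apply: subset_trans (Mc j) _; apply/bigcupsP => C CN.
  by apply: (bigcup_sup C) => //; apply: (subsetP NFB).
- case: unliftP ii' => [j ->|->]; case: unliftP => [j' ->|->] ii' //.
  + by apply: Md; apply: contraNneq ii' => ->.
  + by rewrite disjoint_sym.
- by case: unliftP.
- case: unliftP ii' => [j ->|->]; case: unliftP => [j' ->|->] ii' //.
  + by apply: Mt; apply: contraNneq ii' => ->.
  + by rewrite touchC.
Qed.

Lemma clique_minor_over_minor FB h :
  branch_family FB -> clique_minor_over FB h -> clique_minor h.
Proof.
move=> [_ cn] [M [MF _ Md Mc Mt]]; exists M; split=> // i.
have [C CF /subsetP CM] := MF i; have [_ /set0Pn[x xC]] := cn C CF.
by apply/set0Pn; exists x; apply: CM.
Qed.

Lemma connect_stable (T : finType) (r : rel T) (A : {set T}) x y :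
  (forall u v, u \in A -> r u v -> v \in A) -> connect r x y -> x \in A -> y \in A.
Proof.
move=> H /connectP[p rp ->]; elim: p x rp => //= z p IH x /andP[xz zp] xA.
by apply: IH => //; apply: H xz.
Qed.

Definition component (B : {set V}) (z : V) : {set V} := [set v | connect (within B) z v].

Lemma component_refl (B : {set V}) z : z \in component B z.
Proof. by rewrite inE connect0. Qed.

Lemma component_sub (B : {set V}) z : z \in B -> component B z \subset B.
Proof.
move=> zB; apply/subsetP => v; rewrite inE => zv.
by apply: connect_stable zv zB => u w _ /and3P[].
Qed.

Lemma component_step (B : {set V}) z u v : u \in component B z -> u \in B -> v \in B -> e u v -> v \in component B z.
Proof.
rewrite !inE => zu uB vB uv; apply: connect_trans zu _.
by apply: connect1; rewrite /within /= uv uB.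
Qed.

Lemma conn_component (B : {set V}) z : conn (component B z).
Proof.
apply: (@conn_from z) => x; rewrite inE => zx.
suff : x \in [set v | (v \in component B z) && connect (within (component B z)) z v].
  by rewrite inE => /andP[].
apply: connect_stable zx _; last by rewrite !inE !connect0.
move=> u v; rewrite [u \in _]inE => /andP[uc zu] /and3P[uv uB vB].
have vc := component_step uc uB vB uv.
rewrite inE vc; apply: connect_trans zu (connect1 _).
by rewrite /within /= uv uc vc.
Qed.

(** A walk in [Q] from [z] to [a] must leave [Q :\: P], and it can leave only into [P]. So trimming
    [Q] at [P] keeps an edge to [P]. *)
Lemma component_touch (P Q : {set V}) z a :
  conn Q -> z \in Q -> z \notin P -> a \in Q -> a \in P -> touch (component (Q :\: P) z) P.
Proof.
move=> /connP cQ zQ zP aQ aP.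
have zD : z \in Q :\: P by rewrite inE zP.
apply: contraTT (aP) => nt.
have ac : a \in component (Q :\: P) z.
  apply: connect_stable (cQ _ _ zQ aQ) (component_refl _ _) => u v uc /and3P[uv uQ vQ].
  have uD := subsetP (component_sub zD) _ uc.
  apply: (component_step uc uD) => //; rewrite inE vQ andbT.
  by apply: contra nt => vP; apply/touchP; exists u, v.
by have := subsetP (component_sub zD) _ ac; rewrite inE => /andP[].
Qed.

(* Contract the x-stars to branch sets; the y-stars, trimmed at their first
   vertex in the path towards x, are further branch sets, and each walk gives
   an edge between the two kinds.  A star with a single walk is discarded, so
   that y is not swallowed by an x-star. *)
Lemma noncrossing_walks_le (h : nat) (I : finType) (W : {set I})
    (x a y : I -> V) (P Q : I -> {set V}) :
  ~ clique_minor h ->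
  {in W, forall w, conn (P w) /\ conn (Q w)} ->
  {in W, forall w, [/\ x w \in P w, a w \in P w, a w \in Q w & y w \in Q w]} ->
  {in W &, forall w w', w != w' ->
     [/\ x w != x w' -> [disjoint P w & P w'], y w != y w' -> [disjoint Q w & Q w'],
         [disjoint P w & Q w'] & (x w, y w) != (x w', y w')]} ->
  #|W| <= 2 ^ h * (#|x @: W| + #|y @: W|) + #|y @: W|.
Proof.
move=> nminor cPQ inPQ nc.
pose W' := [set w in W | [exists w' in W, (w' != w) && (y w' == y w)]].
have W'W : W' \subset W by apply/subsetP => w; rewrite inE => /andP[].
have cW : #|W| <= #|W'| + #|y @: W|.
  rewrite -(cardsID W' W) (setIidPr W'W) leq_add2l.
  rewrite -(card_in_imset (f := y)); first by apply/subset_leq_card/imsetS/subsetDl.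
  move=> w w'; rewrite !inE => /andP[+ wW]; rewrite wW /= => /exists_inPn H /andP[_ w'W] yy.
  apply/eqP; have := H w' w'W; rewrite yy eqxx andbT negbK eq_sym => //.
apply: leq_trans cW _; rewrite leq_add2r.
(* For [w' != w] this is disjointness of [P w'] and [Q w]. For [w' = w] the second walk [v] of the
   star is needed: its [Q v] contains the same end and is disjoint from [P w]. *)
have yP w w' : w \in W' -> w' \in W -> y w \notin P w'.
  rewrite inE => /andP[wW /exists_inP[v vW /andP[vw /eqP yv]]] w'W.
  apply/negP => yP; have [ww'|ww'] := eqVneq w w'.
    rewrite -ww' in yP; rewrite eq_sym in vw.
    have [_ _ /pred0P/(_ (y w)) /= + _] := nc w v wW vW vw.
    by rewrite yP -yv; have [_ _ _ ->] := inPQ v vW.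
  rewrite eq_sym in ww'; have [_ _ + _] := nc w' w w'W wW ww'.
  by move=> /pred0P/(_ (y w)) /=; rewrite yP; have [_ _ _ ->] := inPQ w wW.
pose R w := component (Q w :\: P w) (y w).
have yD w : w \in W' -> y w \in Q w :\: P w.
  move=> wW'; have wW := subsetP W'W w wW'.
  by rewrite inE yP //; have [_ _ _ ->] := inPQ w wW.
have RQ w : w \in W' -> R w \subset Q w.
  by move=> wW'; apply: subset_trans (component_sub (yD w wW')) (subsetDl _ _).
have RP w w' : w \in W' -> w' \in W' -> [disjoint P w & R w'].
  move=> wW' w'W'; have [<-|ww'] := eqVneq w w'.
    apply: disjointWr (component_sub (yD w wW')) _.
    by rewrite disjoint_sym -setI_eq0 setIDAC setDIl setDv setI0.
  have [_ _ dPQ _] := nc w w' (subsetP W'W _ wW') (subsetP W'W _ w'W') ww'.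
  exact: disjointWr (RQ _ w'W') dPQ.
pose B z := \bigcup_(w in [set w in W' | x w == z]) P w.
pose C z := \bigcup_(w in [set w in W' | y w == z]) R w.
pose SB := [set B (x w) | w in W']; pose SC := [set C (y w) | w in W'].
have inB w : w \in W' -> P w \subset B (x w).
  by move=> wW'; apply: (bigcup_sup w); rewrite // inE wW' eqxx.
have inC w : w \in W' -> R w \subset C (y w).
  by move=> wW'; apply: (bigcup_sup w); rewrite // inE wW' eqxx.
have xB w : w \in W' -> x w \in B (x w).
  move=> wW'; apply: (subsetP (inB w wW')).
  by have [] := inPQ w (subsetP W'W _ wW').
have yC w : w \in W' -> y w \in C (y w).
  by move=> wW'; apply: (subsetP (inC w wW')); apply: component_refl.
have dBB z z' : z != z' -> [disjoint B z & B z'].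
  move=> zz'; apply/pred0P => v /=; apply/negP => /andP[/bigcupP[w /setIdP[wW' /eqP xw] vw] /bigcupP[w' /setIdP[w'W' /eqP xw'] vw']].
  have ww' : w != w' by apply: contraNneq zz' => ww'; rewrite -xw -xw' ww'.
  have [dP _ _ _] := nc w w' (subsetP W'W _ wW') (subsetP W'W _ w'W') ww'.
  by have /pred0P/(_ v) := dP ltac:(by rewrite xw xw'); rewrite /= vw vw'.
have dCC z z' : z != z' -> [disjoint C z & C z'].
  move=> zz'; apply/pred0P => v /=; apply/negP => /andP[/bigcupP[w /setIdP[wW' /eqP yw] vw] /bigcupP[w' /setIdP[w'W' /eqP yw'] vw']].
  have ww' : w != w' by apply: contraNneq zz' => ww'; rewrite -yw -yw' ww'.
  have [_ dQ _ _] := nc w w' (subsetP W'W _ wW') (subsetP W'W _ w'W') ww'.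
  have /pred0P/(_ v) := dQ ltac:(by rewrite yw yw').
  by rewrite /= (subsetP (RQ _ wW') _ vw) (subsetP (RQ _ w'W') _ vw').
have dBC z z' : [disjoint B z & C z'].
  apply/pred0P => v /=; apply/negP => /andP[/bigcupP[w /setIdP[wW' _] vw] /bigcupP[w' /setIdP[w'W' _] vw']].
  by have /pred0P/(_ v) := RP w w' wW' w'W'; rewrite /= vw vw'.
have bF : branch_family (SB :|: SC).
  split=> [|D /setUP[/imsetP[w wW' ->]|/imsetP[w wW' ->]]]; last 2 first.
  - split; last by apply/set0Pn; exists (x w); apply: xB.
    apply: (@conn_bigcup _ _ _ (x w)) => w' /setIdP[w'W' /eqP <-].
    have w'W := subsetP W'W _ w'W'.
    by have [] := cPQ w' w'W; have [] := inPQ w' w'W.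
  - split; last by apply/set0Pn; exists (y w); apply: yC.
    apply: (@conn_bigcup _ _ _ (y w)) => w' /setIdP[w'W' /eqP <-].
    by split; [apply: conn_component | apply: component_refl].
  apply/trivIsetP => D E /setUP[/imsetP[w wW' ->]|/imsetP[w wW' ->]]
    /setUP[/imsetP[w' w'W' ->]|/imsetP[w' w'W' ->]] DE //.
  + by apply: dBB; apply: contraNneq DE => ->.
  + by rewrite disjoint_sym.
  + by apply: dCC; apply: contraNneq DE => ->.
have [->|W0] := eqVneq W' set0; first by rewrite cards0.
have F0 : SB :|: SC != set0.
  have [w wW'] := set0Pn _ W0; apply/set0Pn; exists (B (x w)).
  by apply/setUP; left; apply: imset_f.
have cF : #|SB :|: SC| <= #|x @: W| + #|y @: W|.
  rewrite cardsU; apply: leq_trans (leq_subr _ _) _; apply: leq_add.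
    have -> : SB = B @: (x @: W') by rewrite -imset_comp.
    by rewrite (leq_trans (leq_imset_card _ _)) // subset_leq_card // imsetS.
  have -> : SC = C @: (y @: W') by rewrite -imset_comp.
  by rewrite (leq_trans (leq_imset_card _ _)) // subset_leq_card // imsetS.
suff nF : 2 * #|W'| <= nadj (SB :|: SC).
  rewrite leqNgt; apply/negP => lt.
  apply: nminor; apply: (clique_minor_over_minor bF); apply: (mader bF F0).
  apply: leq_trans nF; rewrite expnS -mulnA leq_mul2l /=.
  by apply: leq_trans (ltnW lt); rewrite leq_mul2l cF orbT.
(* Each walk accounts for two ordered adjacent pairs; they differ between walks because no two walks
   share both ends. *)
pose pf w := (B (x w), C (y w)); pose pb w := (C (y w), B (x w)).
have BC w w' : w \in W' -> B (x w) != C (y w').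
  move=> wW'; apply/eqP => BC; have /pred0P/(_ (x w)) := dBC (x w) (y w').
  by rewrite /= -BC xB.
have Binj w w' : w \in W' -> w' \in W' -> B (x w) = B (x w') -> x w = x w'.
  move=> wW' w'W' BB; apply/eqP; apply/negPn/negP => /dBB/pred0P/(_ (x w)).
  by rewrite /= -BB xB.
have Cinj w w' : w \in W' -> w' \in W' -> C (y w) = C (y w') -> y w = y w'.
  move=> wW' w'W' CC; apply/eqP; apply/negPn/negP => /dCC/pred0P/(_ (y w)).
  by rewrite /= -CC yC.
have pinj w w' : w \in W' -> w' \in W' -> B (x w) = B (x w') -> C (y w) = C (y w') -> w = w'.
  move=> wW' w'W' /(Binj _ _ wW' w'W') xx /(Cinj _ _ wW' w'W') yy.
  apply/eqP/negPn/negP => /(nc w w' (subsetP W'W _ wW') (subsetP W'W _ w'W'))[_ _ _].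
  by rewrite xx yy eqxx.
have adjBC w : w \in W' -> adjF (B (x w)) (C (y w)).
  move=> wW'; rewrite /adjF BC // touchC; have wW := subsetP W'W _ wW'.
  have [_ cQ] := cPQ w wW; have [_ aP aQ yQ] := inPQ w wW.
  exact: touchS (inC w wW') (inB w wW') (component_touch cQ yQ (yP _ _ wW' wW) aQ aP).
have -> : nadj (SB :|: SC) = #|[set p in setX (SB :|: SC) (SB :|: SC) | adjF p.1 p.2]|.
  rewrite /nadj pair_big_dep /= -sum1_card big_mkcond [RHS]big_mkcond /=.
  by apply: eq_bigr => -[D E] _; rewrite !inE /=; case: ifP => //; case: adjF.
have dfb : [disjoint pf @: W' & pb @: W'].
  apply/pred0P => p /=; apply/negP => /andP[/imsetP[w wW' ->] /imsetP[w' w'W' [/eqP]]].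
  by rewrite (negbTE (BC _ _ wW')).
have -> : 2 * #|W'| = #|pf @: W' :|: pb @: W'|.
  rewrite cardsU (disjoint_setI0 dfb) cards0 subn0 !card_in_imset ?mul2n ?addnn //.
    by move=> w w' wW' w'W' [CC BB]; apply: pinj.
  by move=> w w' wW' w'W' [BB CC]; apply: pinj.
apply/subset_leq_card/subsetP => p /setUP[/imsetP[w wW' ->]|/imsetP[w wW' ->]].
  by rewrite inE in_setX !in_setU /= adjBC // (imset_f _ wW') [C (y w) \in SC](imset_f _ wW') orbT.
by rewrite inE in_setX !in_setU /= adjFC adjBC // [B (x w) \in SB](imset_f _ wW') [C (y w) \in SC](imset_f _ wW') orbT.
Qed.

End Minors.

(** * Congestion of routings *)

Lemma card_family_prod (V T : finType) (F : V -> pred T) :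
  #|(family F : simpl_pred {ffun V -> T})| = \prod_v #|F v|.
Proof. by rewrite card_family foldrE big_map big_enum. Qed.

Lemma card_ffun_zero1 (V : finType) (q : nat) (x : V) :
  #|[set g : {ffun V -> 'I_q.+1} | g x == ord0]| * q.+1 = q.+1 ^ #|V|.
Proof.
pose F v : pred 'I_q.+1 := if v == x then pred1 ord0 else predT.
have -> : #|[set g : {ffun V -> 'I_q.+1} | g x == ord0]| = \prod_v #|F v|.
  rewrite -card_family_prod; apply: eq_card => g; rewrite inE.
  apply/idP/familyP => [gx v|H]; rewrite /F.
    by case: (eqVneq v x) => [->|_] //; rewrite inE.
  by have := H x; rewrite /F eqxx inE.
rewrite (bigD1 x) //= {1}/F eqxx card1 mul1n.
rewrite (eq_bigr (fun=> q.+1)) => [|v /negbTE vx]; last first.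
  by rewrite /F vx; rewrite (eq_card (B := 'I_q.+1)) ?card_ord.
by rewrite prod_nat_const cardC1 -expnSr prednK //; apply/card_gt0P; exists x.
Qed.

(** Pairwise independence of the colours in a uniform random colouring, with denominators
    cleared. *)
Lemma card_ffun_zero2 (V : finType) (q : nat) (x x' : V) :
  #|[set g : {ffun V -> 'I_q.+1} | (g x == ord0) && (g x' == ord0)]| * q.+1 ^ 2
   = q.+1 ^ #|V| * (if x == x' then q.+1 else 1).
Proof.
have [<-|xx'] := eqVneq x x'.
  by rewrite -(card_ffun_zero1 q x) -mulnA mulnn; congr (#|pred_of_set _| * _); apply/setP => g; rewrite !inE andbb.
pose F v : pred 'I_q.+1 := if (v == x) || (v == x') then pred1 ord0 else predT.
have -> : #|[set g : {ffun V -> 'I_q.+1} | (g x == ord0) && (g x' == ord0)]| = \prod_v #|F v|.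
  rewrite -card_family_prod; apply: eq_card => g; rewrite inE.
  apply/andP/familyP => [[gx gx'] v|H]; rewrite /F.
    case: (eqVneq v x) => [->|_] /=; first by rewrite inE.
    by case: (eqVneq v x') => [->|_] //; rewrite inE.
  by have := H x; have := H x'; rewrite /F !eqxx orbT /= !inE.
rewrite (bigD1 x) //= (bigD1 x') 1?eq_sym //= {1 2}/F !eqxx orbT !card1 !mul1n.
rewrite (eq_bigr (fun=> q.+1)) => [|v /andP[/negbTE vx /negbTE vx']]; last first.
  by rewrite /F vx vx' /=; rewrite (eq_card (B := 'I_q.+1)) ?card_ord.
rewrite prod_nat_const muln1 -expnD; congr (_ ^ _).
rewrite -(cardC (pred2 x x')) card2 xx' addnC; congr (_ + _).
by apply: eq_card => v; rewrite !inE negb_or.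
Qed.

(** The first moment method in integers; [i0] guarantees a nonempty sample space. *)
Lemma ex_leq_of_sum (I : finType) (i0 : I) (F G : I -> nat) :
  \sum_i F i <= \sum_i G i -> exists i, F i <= G i.
Proof.
move=> FG; have [/existsP //|/existsPn H] := boolP [exists i, F i <= G i].
suff : \sum_i G i < \sum_i F i by rewrite ltnNge FG.
rewrite (bigD1 i0) //= [ltnRHS](bigD1 i0) //= -addSn.
by rewrite leq_add ?ltnNge // leq_sum // => j _; rewrite ltnW // ltnNge.
Qed.

(** * Independent sets in sparse conflict graphs *)

Section Sparse.
Context (I : finType) (c : rel I) (s : nat).

Definition conflicts (A : {set I}) : nat := \sum_(i in A) \sum_(j in A) c i j.

Definition mono_conflicts (f : I -> 'I_s.+1) (A : {set I}) : nat :=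
  \sum_(i in A) \sum_(j in A) (c i j && (f i == f j)).

(** Conditional expectations: each new element takes its cheapest colour, which costs at most the
    average, a fraction [1 / s.+1] of its conflicts with the elements already coloured. *)
Lemma greedy_coloring (A : {set I}) : (forall i, ~~ c i i) ->
  exists f : I -> 'I_s.+1, s.+1 * mono_conflicts f A <= conflicts A.
Proof.
move=> irr; have [n] := ubnP #|A|; elim: n A => // n IH A /ltnSE-An.
have [->|/set0Pn[a aA]] := eqVneq A set0.
  by exists (fun=> ord0); rewrite /mono_conflicts big_set0 muln0.
have Aa : a \notin A :\ a by rewrite !inE eqxx.
have [|f fP] := IH (A :\ a); first by move: An; rewrite (cardsD1 a) aA.
pose cost k := \sum_(j in A :\ a) (c a j && (k == f j)) + \sum_(j in A :\ a) (c j a && (f j == k)).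
have [k kP] : exists k, s.+1 * cost k <= \sum_i cost i.
  by apply: (ex_leq_of_sum ord0); rewrite -big_distrr /= sum_nat_const card_ord.
have costE : \sum_k cost k = \sum_(j in A :\ a) c a j + \sum_(j in A :\ a) c j a.
  rewrite /cost big_split /= exchange_big [X in _ + X]exchange_big /=.
  congr (_ + _); apply: eq_bigr => j _.
    rewrite (bigD1 (f j)) //= eqxx andbT big1 ?addn0 // => i /negbTE ->.
    by rewrite andbF.
  rewrite (bigD1 (f j)) //= eqxx andbT big1 ?addn0 // => i; rewrite eq_sym => /negbTE ->.
  by rewrite andbF.
exists (fun i => if i == a then k else f i).
rewrite -(setD1K aA) /mono_conflicts /conflicts !big_setU1 //= !eqxx.
rewrite (negbTE (irr a)) /= !add0n; set f' := fun i => if i == a then k else f i.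
have f'E i : i \in A :\ a -> f' i = f i.
  by rewrite /f' !inE => /andP[/negbTE ->].
have f'a : f' a = k by rewrite /f' eqxx.
have E1 : \sum_(i in A :\ a) (c a i && (k == f' i)) = \sum_(i in A :\ a) (c a i && (k == f i)).
  by apply: eq_bigr => i iA; rewrite f'E.
have E2 : \sum_(i in A :\ a) \sum_(j in a |: A :\ a) (c i j && (f' i == f' j)) =
    \sum_(i in A :\ a) (c i a && (f i == k)) + mono_conflicts f (A :\ a).
  rewrite /mono_conflicts -big_split; apply: eq_bigr => i iA.
  rewrite big_setU1 //= f'a f'E //; congr (_ + _).
  by apply: eq_bigr => j jA; rewrite f'E.
have E3 : \sum_(i in A :\ a) \sum_(j in a |: A :\ a) c i j =
    \sum_(i in A :\ a) c i a + conflicts (A :\ a).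
  by rewrite /conflicts -big_split; apply: eq_bigr => i iA; rewrite big_setU1.
rewrite E1 E2 E3 addnA [leqRHS]addnA mulnDr; rewrite costE /cost in kP.
exact: leq_add.
Qed.

(** The deletion method, derandomised. A colour class acts as a sample of density [1 / s.+1], which
    keeps [#|A| / s.+1] elements but only [conflicts A / s.+1 ^ 2] conflicts; some class is at least
    as good as the average, and its conflicting elements are dropped. *)
Lemma sparse_independent (A : {set I}) : (forall i, ~~ c i i) ->
  exists B : {set I}, [/\ B \subset A, {in B &, forall i j, ~~ c i j} &
     s.+1 * #|A| <= conflicts A + s.+1 ^ 2 * #|B|].
Proof.
move=> irr; have [f fP] := greedy_coloring A irr.
pose cls k := [set i in A | f i == k].
have cA : #|A| = \sum_k #|cls k|.
  rewrite -sum1_card (partition_big f predT) //=; apply: eq_bigr => k _.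
  by rewrite -sum1_card; apply: eq_bigl => i; rewrite inE.
have mA : mono_conflicts f A = \sum_k conflicts (cls k).
  rewrite /mono_conflicts (partition_big f predT) //=; apply: eq_bigr => k _.
  rewrite /conflicts; rewrite [RHS](eq_bigl (fun i => (i \in A) && (f i == k))); last by move=> i; rewrite inE.
  apply: eq_bigr => i /andP[_ /eqP fi].
  rewrite [RHS](eq_bigl (fun i => (i \in A) && (f i == k))); last by move=> j; rewrite inE.
  rewrite [RHS]big_mkcondr /=; apply: eq_bigr => j _.
  by rewrite fi eq_sym; case: eqP; rewrite ?andbT ?andbF.
have [k kP] : exists k, #|A| + s.+1 * conflicts (cls k) <= s.+1 * #|cls k| + mono_conflicts f A.
  apply: (ex_leq_of_sum ord0).
  by rewrite !big_split /= -!big_distrr /= !sum_nat_const card_ord -cA -mA addnC.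
pose D := [set i in cls k | [exists j in cls k, c i j]].
exists (cls k :\: D); split.
- by apply/subsetP => i; rewrite !inE => /andP[_ /andP[]].
- move=> i j /setDP[ik iD] /setDP[jk _]; apply: contra iD => cij.
  by rewrite inE ik; apply/exists_inP; exists j.
have Dc : #|D| <= conflicts (cls k).
  rewrite /conflicts -sum1_card big_mkcond [leqRHS]big_mkcond /=; apply: leq_sum => i _.
  rewrite inE; case: ifP => // /andP[ik /exists_inP[j jk cij]]; rewrite ik.
  by rewrite (bigD1 j) //= cij.
have Dk : #|cls k| <= #|cls k :\: D| + #|D|.
  rewrite -(cardsID D (cls k)) addnC leq_add2l subset_leq_card //; exact: subsetIr.
move: (s.+1) kP fP => t; nia.
Qed.

End Sparse.

Lemma sum_sqr_leq (I : finType) (d : I -> nat) :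
  (\sum_i d i) ^ 2 <= #|I| * \sum_i d i ^ 2.
Proof.
rewrite -(leq_pmul2l (isT : 0 < 2)).
have -> : 2 * (\sum_i d i) ^ 2 = \sum_i \sum_j 2 * (d i * d j).
  rewrite -mulnn big_distrl big_distrr /=; apply: eq_bigr => i _.
  by rewrite !big_distrr.
have -> : 2 * (#|I| * \sum_i d i ^ 2) = \sum_i \sum_j (d i ^ 2 + d j ^ 2).
  under [RHS]eq_bigr do rewrite big_split sum_nat_const /=.
  by rewrite big_split /= sum_nat_const -big_distrr /= addnn mul2n.
by apply: leq_sum => i _; apply: leq_sum => j _; exact: nat_Cauchy.
Qed.

Lemma sum_prod_exchange (I G1 G2 : finType) (A : {pred I}) (c : I -> nat)
    (f : I -> G1 -> nat) (k : I -> G2 -> nat) :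
  \sum_g1 \sum_g2 \sum_(i in A) c i * (f i g1 * k i g2) =
  \sum_(i in A) c i * ((\sum_g1 f i g1) * (\sum_g2 k i g2)).
Proof.
transitivity (\sum_g1 \sum_(i in A) c i * (f i g1 * \sum_g2 k i g2)).
  apply: eq_bigr => g1 _; rewrite exchange_big /=; apply: eq_bigr => i _.
  by rewrite -big_distrr /= -big_distrr.
rewrite exchange_big /=; apply: eq_bigr => i _.
by rewrite -big_distrr /= -big_distrl.
Qed.

Lemma sum_nat_of_bool (I : finType) (A : {pred I}) (P : pred I) :
  \sum_(i in A) P i = #|[set i in A | P i]|.
Proof. by rewrite -sum1dep_card [RHS]big_mkcondr; apply: eq_bigr => i _; case: P. Qed.

(* K0 = r / Q balances the expected numbers of selected walks, centres and
   conflicts in crossings_ge. *)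
Section Congestion.
Context (V : finType) (e : rel V) (e_sym : symmetric e) (h : nat).
Hypothesis no_minor : ~ clique_minor e h.
Context (L : finType) (E : {set L}) (src tgt : L -> V) (p : L -> {set V}).
Context (q T : nat).
Local Notation K0 := (144 * (2 ^ h.+1 + 1)).
Local Notation r := (K0 * q.+1).
Hypothesis pE : {in E, forall l, [/\ conn e (p l), src l \in p l & tgt l \in p l]}.
Definition outs (v : V) : {set L} := [set l in E | src l == v].
Hypothesis out_deg : forall v, #|outs v| <= r * T.
Hypothesis in_deg : forall v, #|[set l in E | tgt l == v]| <= r * T.
Hypothesis mult : forall u v, #|[set l in outs u | tgt l == v]| <= T.
Hypothesis dense : #|V| * (r * T) <= 2 * #|E|.
Hypothesis T_gt0 : 0 < T.

Local Notation D := (r * T).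
Local Notation n := #|V|.
Local Notation Q := q.+1.

Definition meet (l l' : L) : bool := ~~ [disjoint p l & p l'].
Definition crossings : nat := \sum_(l in E) \sum_(l' in E) meet l l'.

(* A walk y - a - x is recorded as its two edges l, m leaving the middle vertex a. *)
Definition walks : {set L * L} :=
  [set w | [&& w.1 \in E, w.2 \in E & src w.1 == src w.2]].

(* Q^2 times the probability that u and v both have colour 0. *)
Definition phi (u v : V) : nat := if u == v then Q else 1.

Lemma walks_sum (F : L -> L -> nat) :
  \sum_(w in walks) F w.1 w.2 = \sum_(l in E) \sum_(m in outs (src l)) F l m.
Proof.
rewrite pair_big_dep /=; apply: eq_bigl => -[l m].
by rewrite !inE /= [src m == _]eq_sym.
Qed.

Lemma walks_sum_swap (F : L -> L -> nat) :
  \sum_(w in walks) F w.1 w.2 = \sum_(l in E) \sum_(m in outs (src l)) F m l.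
Proof.
rewrite walks_sum; under eq_bigr do rewrite big_mkcond.
rewrite exchange_big [RHS]big_mkcond /=; apply: eq_bigr => l _.
rewrite big_mkcond [X in _ = if _ then X else _]big_mkcond; case: ifP => lE.
  apply: eq_bigr => m _; rewrite !inE lE [src m == _]eq_sym.
  by case: (m \in E); case: (src l == src m).
by rewrite big1 // => m _; rewrite inE lE; case: ifP.
Qed.

Lemma phiC u v : phi u v = phi v u.
Proof. by rewrite /phi eq_sym. Qed.

Lemma sum_phi u a : \sum_(m in outs a) phi u (tgt m) <= D + Q * T.
Proof.
apply: (@leq_trans (\sum_(m in outs a) (1 + Q * (tgt m == u)))).
  by apply: leq_sum => m _; rewrite /phi eq_sym; case: eqP => _; rewrite ?muln1 ?muln0; lia.
rewrite big_split /= sum1_card leq_add // -big_distrr /= leq_mul2l.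
by rewrite sum_nat_of_bool mult orbT.
Qed.

Lemma sum_crossings_le (F : L -> L -> nat) k :
  (forall l l', F l l' <= k) ->
  \sum_(l in E) \sum_(l' in E) meet l l' * F l l' <= crossings * k.
Proof.
move=> Fk; rewrite /crossings big_distrl /=; apply: leq_sum => l _.
by rewrite big_distrl /=; apply: leq_sum => l' _; rewrite leq_mul2l Fk orbT.
Qed.

(** For a fixed meeting pair [l], [l'] the companion edges are free: at most [D] choices of [m], and
    [sum_phi] for [m']. *)
Lemma sum_parallel_crossings :
  \sum_(l in E) \sum_(m in outs (src l)) \sum_(l' in E) \sum_(m' in outs (src l'))
     meet l l' * phi (tgt m) (tgt m') <= crossings * (D + Q * T) ^ 2.
Proof.
rewrite (eq_bigr (fun l => \sum_(l' in E) meet l l' *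
  \sum_(m in outs (src l)) \sum_(m' in outs (src l')) phi (tgt m) (tgt m'))); last first.
  move=> l lE; rewrite exchange_big /=; apply: eq_bigr => l' _.
  by rewrite big_distrr; apply: eq_bigr => m _; rewrite big_distrr.
apply: sum_crossings_le => l l'.
apply: (@leq_trans (\sum_(m in outs (src l)) (D + Q * T))).
  by apply: leq_sum => m _; apply: sum_phi.
by rewrite sum_nat_const -mulnn leq_mul2r (leq_trans (out_deg _)) ?orbT // leq_addr.
Qed.

Lemma sum_skew_crossings :
  \sum_(l in E) \sum_(m in outs (src l)) \sum_(l' in E) \sum_(m' in outs (src l'))
     meet l l' * (phi (tgt l) (tgt m') * phi (tgt m) (tgt l'))
   <= crossings * (D + Q * T) ^ 2.
Proof.
rewrite (eq_bigr (fun l => \sum_(l' in E) meet l l' *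
  ((\sum_(m' in outs (src l')) phi (tgt l) (tgt m')) *
   (\sum_(m in outs (src l)) phi (tgt m) (tgt l'))))); last first.
  move=> l lE; rewrite exchange_big /=; apply: eq_bigr => l' _.
  rewrite [X in _ * X]mulnC big_distrl big_distrr; apply: eq_bigr => m _ /=.
  by rewrite big_distrr big_distrr; apply: eq_bigr => m' _ /=; rewrite [phi (tgt m) _ * _]mulnC.
apply: sum_crossings_le => l l'; rewrite -mulnn leq_mul ?sum_phi //.
by under eq_bigr do rewrite phiC; rewrite sum_phi.
Qed.

(** The configurations to be removed before [noncrossing_walks_le] applies. Edges towards the same
    centre may meet, since they are merged into one star; the last clause bars parallel walks, which
    would give the same edge of the minor twice. *)
Definition conflict : rel (L * L) := fun w w' =>
  (w != w') && [|| (tgt w.1 != tgt w'.1) && meet w.1 w'.1,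
    (tgt w.2 != tgt w'.2) && meet w.2 w'.2, meet w.1 w'.2, meet w.2 w'.1 |
    (tgt w.1 == tgt w'.1) && (tgt w.2 == tgt w'.2)].

Lemma card_walks_le : #|walks| <= n * D ^ 2.
Proof.
rewrite -sum1_card (walks_sum (fun _ _ => 1)).
apply: (@leq_trans (\sum_(l in E) D)).
  by apply: leq_sum => l _; rewrite sum1_card.
rewrite sum_nat_const -mulnn [n * _]mulnA leq_mul2r; apply/orP; right.
rewrite -sum1_card (partition_big src predT) //= -sum_nat_const leq_sum // => v _.
by rewrite sum1dep_card out_deg.
Qed.

(** Cauchy-Schwarz: walks are counted by the squares of out-degrees whose sum is at least
    [n * D / 2] by [dense]. *)
Lemma card_walks_ge : n * D ^ 2 <= 4 * #|walks|.
Proof.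
have [->|n0] := posnP n; first by rewrite mul0n.
have EE : \sum_v #|outs v| = #|E|.
  rewrite -[RHS]sum1_card (partition_big src predT) //=; apply: eq_bigr => v _.
  by rewrite sum1dep_card.
have WE : #|walks| = \sum_v #|outs v| ^ 2.
  rewrite -sum1_card (walks_sum (fun _ _ => 1)) (partition_big src predT) //=.
  apply: eq_bigr => v _; rewrite (eq_bigr (fun=> #|outs v|)); last first.
    by move=> l /andP[_ /eqP ->]; rewrite sum1_card.
  by rewrite sum_nat_cond_const -mulnn.
have := sum_sqr_leq (fun v => #|outs v|); rewrite EE -WE => CS.
rewrite -(leq_pmul2l n0); apply: leq_trans (_ : (2 * #|E|) ^ 2 <= _).
  by rewrite mulnA mulnn -expnMn leq_exp2r.
by rewrite expnMn; lia.
Qed.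

(** One term per clause of [conflict]. In the first two the meeting edges have different centres, so
    their [phi] is 1. In the last both factors are [Q], and a given walk has at most [D * T]
    parallel ones: [D] choices of the first edge by [in_deg], then [T] of the second by [mult]. *)
Lemma sum_conflicts_le :
  \sum_(w in walks) \sum_(w' in walks)
     conflict w w' * (phi (tgt w.1) (tgt w'.1) * phi (tgt w.2) (tgt w'.2))
  <= 4 * crossings * (D + Q * T) ^ 2 + Q ^ 2 * (n * D ^ 2 * (D * T)).
Proof.
pose t1 w w' := meet w.1 w'.1 * phi (tgt w.2) (tgt w'.2).
pose t2 w w' := meet w.2 w'.2 * phi (tgt w.1) (tgt w'.1).
pose t3 w w' := meet w.1 w'.2 * (phi (tgt w.1) (tgt w'.1) * phi (tgt w.2) (tgt w'.2)).
pose t4 w w' := meet w.2 w'.1 * (phi (tgt w.2) (tgt w'.2) * phi (tgt w.1) (tgt w'.1)).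
pose t5 w w' := Q ^ 2 * ((tgt w'.1 == tgt w.1) && (tgt w'.2 == tgt w.2)).
apply: (@leq_trans (\sum_(w in walks) \sum_(w' in walks)
    (t1 w w' + t2 w w' + t3 w w' + t4 w w' + t5 w w'))).
  apply: leq_sum => w _; apply: leq_sum => w' _.
  rewrite /conflict /t1 /t2 /t3 /t4 /t5 /phi [tgt w'.1 == tgt w.1]eq_sym [tgt w'.2 == tgt w.2]eq_sym.
  case: (w != w') => //=.
  by case: (tgt w.1 == tgt w'.1); case: (tgt w.2 == tgt w'.2);
     do 4 case: meet; rewrite /= -?mulnn; nia.
under eq_bigr do rewrite 4!big_split /=; rewrite 4!big_split /=.
have T1 : \sum_(w in walks) \sum_(w' in walks) t1 w w' <= crossings * (D + Q * T) ^ 2.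
  rewrite (walks_sum (fun a b => \sum_(w' in walks) t1 (a, b) w')).
  under eq_bigr => l _ do under eq_bigr => m _ do
    rewrite (walks_sum (fun a b => t1 (l, m) (a, b))).
  exact: sum_parallel_crossings.
have T2 : \sum_(w in walks) \sum_(w' in walks) t2 w w' <= crossings * (D + Q * T) ^ 2.
  rewrite (walks_sum_swap (fun a b => \sum_(w' in walks) t2 (a, b) w')).
  under eq_bigr => l _ do under eq_bigr => m _ do
    rewrite (walks_sum_swap (fun a b => t2 (m, l) (a, b))).
  exact: sum_parallel_crossings.
have T3 : \sum_(w in walks) \sum_(w' in walks) t3 w w' <= crossings * (D + Q * T) ^ 2.
  rewrite (walks_sum (fun a b => \sum_(w' in walks) t3 (a, b) w')).
  under eq_bigr => l _ do under eq_bigr => m _ do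
    rewrite (walks_sum_swap (fun a b => t3 (l, m) (a, b))).
  exact: sum_skew_crossings.
have T4 : \sum_(w in walks) \sum_(w' in walks) t4 w w' <= crossings * (D + Q * T) ^ 2.
  rewrite (walks_sum_swap (fun a b => \sum_(w' in walks) t4 (a, b) w')).
  under eq_bigr => l _ do under eq_bigr => m _ do
    rewrite (walks_sum (fun a b => t4 (m, l) (a, b))).
  exact: sum_skew_crossings.
have T5 : \sum_(w in walks) \sum_(w' in walks) t5 w w' <= Q ^ 2 * (n * D ^ 2 * (D * T)).
  under eq_bigr do rewrite -big_distrr /=; rewrite -big_distrr leq_mul //=.
  apply: (@leq_trans (\sum_(w in walks) D * T)); last first.
    by rewrite sum_nat_const leq_mul2r card_walks_le orbT.
  apply: leq_sum => w _.
  rewrite (walks_sum (fun a b => nat_of_bool ((tgt a == tgt w.1) && (tgt b == tgt w.2)))).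
  apply: (@leq_trans (\sum_(l in E) (tgt l == tgt w.1) * T)).
    apply: leq_sum => l _; case: (tgt l == tgt w.1) => /=; last by rewrite big1.
    by rewrite mul1n sum_nat_of_bool mult.
  by rewrite -big_distrl leq_mul2r /= sum_nat_of_bool in_deg orbT.
have K4 a b : 4 * a * b = a * b + a * b + a * b + a * b by lia.
by rewrite K4; do 4 apply: leq_add => //.
Qed.

(* g1 and g2 are independent uniform colourings; the centres are the vertices of
   colour 0, so each vertex is a centre of either kind with probability 1 / Q. *)
Definition sel_walks (g1 g2 : {ffun V -> 'I_Q}) : {set L * L} :=
  [set w in walks | (g1 (tgt w.1) == ord0) && (g2 (tgt w.2) == ord0)].

Lemma sel_walks_le (g1 g2 : {ffun V -> 'I_Q}) (s : nat) :
  s.+1 * #|sel_walks g1 g2| <= conflicts conflict (sel_walks g1 g2) +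
    s.+1 ^ 2 * (2 ^ h * (#|[set v | g1 v == ord0]| + #|[set v | g2 v == ord0]|)
                + #|[set v | g2 v == ord0]|).
Proof.
have [|B [BW Bc Bs]] := sparse_independent s (c := conflict) (sel_walks g1 g2).
  by move=> w; rewrite /conflict eqxx.
apply: leq_trans Bs _; rewrite leq_add2l leq_mul2l; apply/orP; right.
have inW w : w \in B -> [/\ w.1 \in E, w.2 \in E, src w.1 = src w.2,
    g1 (tgt w.1) == ord0 & g2 (tgt w.2) == ord0].
  by move=> /(subsetP BW); rewrite !inE => /andP[/and3P[? ? /eqP ?] /andP[]].
have := @noncrossing_walks_le V e e_sym h _ B (fun w => tgt w.1) (fun w => src w.1)
  (fun w => tgt w.2) (fun w => p w.1) (fun w => p w.2) no_minor.
move=> H; apply: leq_trans (H _ _ _) _.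
- by move=> w /inW[w1 w2 _ _ _]; have [-> _ _] := pE w1; have [-> _ _] := pE w2.
- by move=> w /inW[w1 w2 ww _ _]; have [_ s1 t1] := pE w1; have [_ s2 t2] := pE w2; rewrite {2}ww.
- move=> w w' wB w'B ww'; have := Bc w w' wB w'B.
  rewrite /conflict /meet ww' /= !negb_or !negb_and !negbK => /and5P[c1 c2 c3 _ c5].
  split=> [/negbTE t1|/negbTE t2||]; [by rewrite t1 in c1 | by rewrite t2 in c2 | exact: c3 | exact: c5].
- have s1 : [set tgt w.1 | w in B] \subset [set v | g1 v == ord0].
    by apply/subsetP => v /imsetP[w /inW[_ _ _ ? _] ->]; rewrite inE.
  have s2 : [set tgt w.2 | w in B] \subset [set v | g2 v == ord0].
    by apply/subsetP => v /imsetP[w /inW[_ _ _ _ ?] ->]; rewrite inE.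
  by apply: leq_add; [apply: leq_mul => //; apply: leq_add|]; apply: subset_leq_card.
Qed.

Lemma sum_ffun_zero1 v : (\sum_(g : {ffun V -> 'I_Q}) (g v == ord0)) * Q = Q ^ n.
Proof.
rewrite -(card_ffun_zero1 q v); congr (_ * _).
by rewrite -sum1dep_card [RHS]big_mkcond; apply: eq_bigr => g _; case: (_ == _).
Qed.

Lemma sum_ffun_zero2 u v :
  (\sum_(g : {ffun V -> 'I_Q}) (g u == ord0) * (g v == ord0)) * Q ^ 2 = Q ^ n * phi u v.
Proof.
rewrite -card_ffun_zero2; congr (_ * _).
by rewrite -sum1dep_card [RHS]big_mkcond; apply: eq_bigr => g _; do 2 case: (_ == _).
Qed.

Lemma sum_sel_walks :
  (\sum_g1 \sum_g2 #|sel_walks g1 g2|) * Q ^ 2 = #|walks| * (Q ^ n) ^ 2.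
Proof.
transitivity ((\sum_(g1 : {ffun V -> 'I_Q}) \sum_(g2 : {ffun V -> 'I_Q}) \sum_(w in walks)
    1 * ((g1 (tgt w.1) == ord0) * (g2 (tgt w.2) == ord0))) * Q ^ 2).
  congr (_ * _); apply: eq_bigr => g1 _; apply: eq_bigr => g2 _.
  rewrite -sum_nat_of_bool; apply: eq_bigr => w _.
  by case: (_ == _); case: (_ == _).
rewrite (sum_prod_exchange _ (fun=> 1) (fun w (g : {ffun V -> 'I_Q}) => nat_of_bool (g (tgt w.1) == ord0))
  (fun w (g : {ffun V -> 'I_Q}) => nat_of_bool (g (tgt w.2) == ord0))).
rewrite big_distrl -sum_nat_const; apply: eq_bigr => w _.
by rewrite /= mul1n -[Q ^ 2]mulnn mulnACA !sum_ffun_zero1 mulnn.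
Qed.

Lemma sum_sel_conflicts :
  (\sum_g1 \sum_g2 conflicts conflict (sel_walks g1 g2)) * Q ^ 4 =
  (Q ^ n) ^ 2 * \sum_(w in walks) \sum_(w' in walks)
     conflict w w' * (phi (tgt w.1) (tgt w'.1) * phi (tgt w.2) (tgt w'.2)).
Proof.
transitivity ((\sum_(g1 : {ffun V -> 'I_Q}) \sum_(g2 : {ffun V -> 'I_Q}) \sum_(u in setX walks walks) conflict u.1 u.2 *
    (((g1 (tgt u.1.1) == ord0) * (g1 (tgt u.2.1) == ord0)) *
     ((g2 (tgt u.1.2) == ord0) * (g2 (tgt u.2.2) == ord0)))) * Q ^ 4).
  congr (_ * _); apply: eq_bigr => g1 _; apply: eq_bigr => g2 _.
  rewrite /conflicts pair_big_dep /= big_mkcond [RHS]big_mkcond.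
  apply: eq_bigr => -[w w'] _; rewrite in_setX ![_ \in sel_walks _ _]inE.
  case: (w \in walks); case: (w' \in walks) => //=; rewrite ?andbF //.
  by do 4 case: (_ == ord0) => //=; rewrite ?muln1 ?muln0.
rewrite (sum_prod_exchange _ (fun u => nat_of_bool (conflict u.1 u.2))
  (fun u (g : {ffun V -> 'I_Q}) => (g (tgt u.1.1) == ord0) * (g (tgt u.2.1) == ord0))
  (fun u (g : {ffun V -> 'I_Q}) => (g (tgt u.1.2) == ord0) * (g (tgt u.2.2) == ord0))).
rewrite pair_big_dep big_distrl big_distrr; apply: eq_big => [[w w']|[w w'] _]; first by rewrite in_setX.
rewrite /= -mulnA [RHS]mulnCA; congr (_ * _); rewrite -[4]/(2 + 2) expnD mulnACA !sum_ffun_zero2.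
by rewrite mulnACA mulnn.
Qed.

Lemma sum_centers :
  (\sum_(g1 : {ffun V -> 'I_Q}) \sum_(g2 : {ffun V -> 'I_Q})
     (2 ^ h * (#|[set v | g1 v == ord0]| + #|[set v | g2 v == ord0]|)
                + #|[set v | g2 v == ord0]|)) * Q =
  (Q ^ n) ^ 2 * (n * (2 ^ h.+1 + 1)).
Proof.
have Z : (\sum_(g : {ffun V -> 'I_Q}) #|[set v | g v == ord0]|) * Q = Q ^ n * n.
  transitivity ((\sum_(g : {ffun V -> 'I_Q}) \sum_v (g v == ord0)) * Q).
    congr (_ * _); apply: eq_bigr => g _.
    by rewrite -sum1dep_card big_mkcond; apply: eq_bigr => v _; case: (_ == _).
  rewrite exchange_big big_distrl mulnC -sum_nat_const; apply: eq_bigr => v _.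
  exact: sum_ffun_zero1.
have cG : #|{ffun V -> 'I_Q}| = Q ^ n by rewrite card_ffun card_ord.
under eq_bigr do rewrite big_split -big_distrr big_split /= sum_nat_const cG.
rewrite big_split -big_distrr big_split -big_distrr /= !sum_nat_const cG.
move: Z; set S := \sum_g _ => Z.
rewrite mulnDl -!mulnA mulnDl -!mulnA Z [2 ^ h.+1]expnS; move: (2 ^ h) (Q ^ n) n; lia.
Qed.

Lemma crossings_ge : n * r ^ 3 * T ^ 2 <= 16 * (K0 + 1) ^ 2 * crossings.
Proof.
have K00 : 0 < K0 by rewrite muln_gt0 addn1.
have r0 : 0 < r by rewrite muln_gt0 K00.
(* In units of [n * r ^ 3 * T ^ 4 / Q ^ 2], this [s.+1] makes the selected walks count at least 3/2,
   the parallel walks at most 1 and the centres 1/4, because [r = K0 * Q] and 144 = 4 * 36. The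
   remaining 1/4 must be paid by crossings, which gives the factor 16 = 4 * 4. *)
have [s sE] : exists s, s.+1 = 6 * r * T ^ 2.
  by exists (6 * r * T ^ 2).-1; rewrite prednK // muln_gt0 [0 < T ^ 2]expn_gt0 T_gt0 muln_gt0 r0.
have N0 : 0 < (Q ^ n) ^ 2 by rewrite !expn_gt0.
have main : s.+1 * Q ^ 2 * #|walks| <=
    \sum_(w in walks) \sum_(w' in walks)
     conflict w w' * (phi (tgt w.1) (tgt w'.1) * phi (tgt w.2) (tgt w'.2)) +
    s.+1 ^ 2 * Q ^ 3 * (n * (2 ^ h.+1 + 1)).
  rewrite -(leq_pmul2l N0) mulnDr -sum_sel_conflicts.
  have -> : (Q ^ n) ^ 2 * (s.+1 * Q ^ 2 * #|walks|) =
     (\sum_g1 \sum_g2 s.+1 * #|sel_walks g1 g2|) * Q ^ 4.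
    under [X in _ = X * _]eq_bigr do rewrite -big_distrr; rewrite -big_distrr -[4]/(2 + 2) expnD /=.
    rewrite -[RHS]mulnA [X in _ = _ * X]mulnA sum_sel_walks; move: ((Q ^ n) ^ 2) (Q ^ 2) (#|walks|) (s.+1) => ? ? ? ?; lia.
  have -> : (Q ^ n) ^ 2 * (s.+1 ^ 2 * Q ^ 3 * (n * (2 ^ h.+1 + 1))) =
     (\sum_(g1 : {ffun V -> 'I_Q}) \sum_(g2 : {ffun V -> 'I_Q}) s.+1 ^ 2 *
       (2 ^ h * (#|[set v | g1 v == ord0]| + #|[set v | g2 v == ord0]|)
                + #|[set v | g2 v == ord0]|)) * Q ^ 4.
    under [X in _ = X * _]eq_bigr do rewrite -big_distrr; rewrite -big_distrr [Q ^ 4]expnS /=.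
    rewrite -[RHS]mulnA [X in _ = _ * X]mulnA sum_centers; move: ((Q ^ n) ^ 2) (s.+1 ^ 2) (n * _) (Q ^ 3) => ? ? ? ?; lia.
  rewrite -mulnDl leq_mul2r -big_split; apply/orP; right; apply: leq_sum => g1 _.
  by rewrite -big_split; apply: leq_sum => g2 _; apply: sel_walks_le.
have {}main := leq_trans main (leq_add sum_conflicts_le (leqnn _)).
rewrite sE in main; have W := card_walks_ge.
have QT : 0 < Q ^ 2 * T ^ 2 by rewrite muln_gt0 !expn_gt0 T_gt0.
rewrite -(leq_pmul2l QT).
have E1 : 6 * r * T ^ 2 * Q ^ 2 * (4 * #|walks|) = 4 * (6 * r * T ^ 2 * Q ^ 2 * #|walks|) by lia.
have := leq_mul (leqnn (6 * r * T ^ 2 * Q ^ 2)) W; rewrite E1 => W'.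
have {W'} := leq_trans W' (leq_mul (leqnn 4) main).
move: (crossings) (n) (2 ^ h.+1 + 1) => X N C; move: (Q) => k.
rewrite !expnS !expn0 !muln1; nia.
Qed.

Lemma crossings_le : crossings <= \sum_v #|[set l in E | v \in p l]| ^ 2.
Proof.
apply: (@leq_trans (\sum_(l in E) \sum_(l' in E) \sum_v (v \in p l) * (v \in p l'))).
  apply: leq_sum => l _; apply: leq_sum => l' _; rewrite /meet.
  case: (boolP [disjoint p l & p l']) => //= /pred0Pn[v /andP[/= vl vl']].
  by rewrite (bigD1 v) //= vl vl'.
under eq_bigr do rewrite exchange_big; rewrite exchange_big /=; apply: leq_sum => v _.
under eq_bigr do rewrite -big_distrr /=.
by rewrite -big_distrl /= !sum_nat_of_bool mulnn.
Qed.

Theorem congestion :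
  n * r ^ 3 * T ^ 2 <= 16 * (K0 + 1) ^ 2 * \sum_v #|[set l in E | v \in p l]| ^ 2.
Proof.
apply: leq_trans crossings_ge _; rewrite leq_mul2l crossings_le orbT //.
Qed.

End Congestion.

(** * Spreading weights *)

Section Near.
Context (V : finType) (e : rel V) (w : V -> nat).

Definition weight (P : {set V}) : nat := \sum_(v in P) w v.

(** Intrinsic w-distance at most [k] in [Z]. Connected sets stand in for paths, since only
    connectivity, ends and weight matter. Both ends are weighed, so a vertex is at distance [w x]
    from itself. *)
Definition near (Z : {set V}) (k : nat) (x y : V) : bool :=
  [exists P : {set V}, [&& P \subset Z, conn e P, x \in P, y \in P & weight P <= k]].

Lemma nearP (Z : {set V}) k x y :
  reflect (exists P : {set V}, [/\ P \subset Z, conn e P, x \in P, y \in P & weight P <= k])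
    (near Z k x y).
Proof. by apply: (iffP existsP) => -[P]; [move/and5P | move/and5P]; exists P. Qed.

Definition clumped (k : nat) (S : {set V}) : bool :=
  [forall x in S, forall y in S, near setT k x y].

Definition clump_family (r k : nat) (FS : {set {set V}}) : bool :=
  trivIset FS && [forall S in FS, (#|S| == r) && clumped k S].

End Near.

Lemma card_triples (T : nat) (V : finType) (B : {set 'I_T * V * V}) :
  #|B| = \sum_(t < T) \sum_x \sum_y ((t, x, y) \in B).
Proof.
rewrite -sum1_card big_mkcond pair_big pair_big /=.
by apply: eq_bigr => -[[t x] y] _ /=; case: (_ \in B).
Qed.

(** * Iterated reweighting by loads *)

Section Process.
Context (V : finType) (e : rel V) (e_sym : symmetric e) (h : nat).
Hypothesis no_minor : ~ clique_minor e h.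
Context (q delta : nat).
Local Notation K0 := (144 * (2 ^ h.+1 + 1)).
Local Notation r := (K0 * q.+1).
Local Notation n := #|V|.
Local Notation Xi := (16 * (K0 + 1) ^ 2).

Definition routing (w : V -> nat) (lab : rel V) (pt : V -> V -> {set V}) : Prop :=
  [/\ forall x y, lab x y -> [/\ conn e (pt x y), x \in pt x y & y \in pt x y],
      forall x, \sum_y lab x y <= r, forall y, \sum_x lab x y <= r,
      n * r <= 2 * \sum_x \sum_y lab x y &
      forall x y, lab x y -> weight w (pt x y) <= delta].

Definition load (lab : rel V) (pt : V -> V -> {set V}) (v : V) : nat :=
  \sum_x \sum_y (lab x y && (v \in pt x y)).

(** The demand graph is complete with loops on each member of [FS], so a covered vertex has degree
    exactly [r]. *)
Lemma clump_routing (w : V -> nat) (FS : {set {set V}}) :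
  clump_family e w r delta FS -> n <= 2 * #|cover FS| ->
  exists lab pt, routing w lab pt.
Proof.
move=> /andP[tr /forall_inP FSP] nFS.
pose lab x y := [exists S in FS, (x \in S) && (y \in S)].
have labE x S y : S \in FS -> x \in S -> lab x y = (y \in S).
  move=> SF xS; apply/exists_inP/idP => [[S' SF' /andP[xS' yS']]|yS]; last by exists S; rewrite ?xS.
  by rewrite -(def_pblock tr SF xS) (def_pblock tr SF' xS').
have labC x y : lab x y = lab y x.
  by apply/exists_inP/exists_inP => -[S SF /andP[? ?]]; exists S => //; apply/andP.
have deg x : \sum_y lab x y = (x \in cover FS) * r.
  have [/bigcupP[S SF xS]|xF] := boolP (x \in cover FS).
    under eq_bigr do rewrite (labE x S) //.
    have /FSP/andP[/eqP <- _] := SF.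
    by rewrite mul1n -sum1_card [RHS]big_mkcond; apply: eq_bigr => y _; case: (_ \in _).
  rewrite big1 // => y _; apply/eqP; rewrite eqb0; apply: contra xF => /exists_inP[S SF /andP[xS _]].
  by apply/bigcupP; exists S.
have nr x y : lab x y -> exists P, [/\ conn e P, x \in P, y \in P & weight w P <= delta].
  move=> /exists_inP[S /FSP/andP[_ /forall_inP cS] /andP[/cS/forall_inP cx /cx/nearP[P []]]].
  by exists P.
exists lab, (fun x y => odflt set0 [pick P : {set V} | [&& conn e P, x \in P, y \in P & weight w P <= delta]]).
split=> [x y /nr[P [c1 c2 c3 c4]]|x|y||x y /nr[P [c1 c2 c3 c4]]].
- by case: pickP => [P' /and4P[]|/(_ P)] //=; rewrite c1 c2 c3 c4.
- by rewrite deg; case: (_ \in _); rewrite ?mul1n.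
- by under eq_bigr do rewrite labC; rewrite deg; case: (_ \in _); rewrite ?mul1n.
- under eq_bigr do rewrite deg; rewrite -big_distrl /= [leqRHS]mulnA leq_mul2r.
  have -> : \sum_x (x \in cover FS) = #|cover FS|.
    by rewrite -sum1_card [RHS]big_mkcond; apply: eq_bigr => y _; case: (_ \in _).
  by rewrite nFS orbT.
- by case: pickP => [P' /and4P[]|/(_ P)] //=; rewrite c1 c2 c3 c4.
Qed.

Lemma routing_size w lab pt : routing w lab pt -> \sum_x \sum_y lab x y <= n * r.
Proof. by move=> [_ H _ _ _]; rewrite -sum_nat_const leq_sum. Qed.

Lemma load_le w lab pt v : routing w lab pt -> load lab pt v <= n * r.
Proof.
move=> /routing_size; apply: leq_trans; apply: leq_sum => x _; apply: leq_sum => y _.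
by case: (lab x y) => //=; case: (_ \in _).
Qed.

Lemma load_weight_le w lab pt : routing w lab pt ->
  \sum_v w v * load lab pt v <= n * r * delta.
Proof.
move=> rt; have [_ _ _ _ sh] := rt.
apply: (@leq_trans (\sum_x \sum_y lab x y * delta)); last first.
  under eq_bigr do rewrite -big_distrl /=; rewrite -big_distrl leq_mul2r.
  by rewrite (routing_size rt) orbT.
rewrite /load; under eq_bigr do rewrite big_distrr /=; rewrite exchange_big leq_sum // => x _.
under eq_bigr do rewrite big_distrr /=; rewrite exchange_big leq_sum // => y _.
have [xy|_] /= := boolP (lab x y); last by rewrite big1 // => v _; rewrite muln0.
rewrite mul1n; apply: leq_trans (sh x y xy); rewrite /weight [leqRHS]big_mkcond /=.
by apply: leq_sum => v _; case: (_ \in _); rewrite ?muln1 ?muln0.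
Qed.

Hypothesis delta_ge : n ^ 2 * r <= delta.

(** The cross term is twice the total w-weight of the chosen sets, at most [2 * (n * r * delta)].
    The squared loads are at most [n * (n * r) ^ 2], and [delta_ge] is what fits them into one more
    [n * r * delta]. *)
Lemma load_energy w lab pt : routing w lab pt ->
  \sum_v (w v + load lab pt v) ^ 2 <= \sum_v w v ^ 2 + 3 * (n * r * delta).
Proof.
move=> rt; under eq_bigr do rewrite sqrnD; rewrite 2!big_split /= -big_distrr /=.
have L1 := load_weight_le rt.
have L2 : \sum_v load lab pt v ^ 2 <= n * r * delta.
  apply: (@leq_trans (\sum_(v : V) (n * r) ^ 2)).
    by apply: leq_sum => v _; rewrite leq_exp2r // (load_le v rt).
  rewrite sum_nat_const; apply: leq_trans (leq_mul (leqnn (n * r)) delta_ge).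
  by move: (r) (n) => a b; lia.
move: L1 L2; move: (\sum_v w v ^ 2) (n * r * delta) => a b; lia.
Qed.

(* T steps of the process that adds to w the load of a routing of short paths
   inside clumped r-sets covering half of the vertices. *)
Definition run (T : nat) : Prop :=
  exists (w : V -> nat) (lab : nat -> rel V) (pt : nat -> V -> V -> {set V}),
  [/\ forall t, t < T -> exists w', routing w' (lab t) (pt t),
      forall v, w v = 1 + \sum_(t < T) load (lab t) (pt t) v &
      \sum_v w v ^ 2 <= n + 3 * (n * r * delta) * T].

Definition spread (T : nat) : Prop :=
  exists w : V -> nat, [/\ forall v, 0 < w v,
    \sum_v w v ^ 2 <= n + 3 * (n * r * delta) * T &
    forall FS, clump_family e w r delta FS -> 2 * #|cover FS| < n].

(* The sum of w^2 grows by at most 3 n r delta in a step, but congestion forces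
   quadratic growth in T, so the process stops. *)
Lemma run_or_spread T : run T \/ spread T.
Proof.
elim: T => [|T [[w [lab [pt [rt wE wn]]]]|[w [w0 wn wF]]]].
- left; exists (fun=> 1), (fun _ _ _ => false), (fun _ _ _ => set0); split=> //.
  + by move=> v; rewrite big_ord0.
  + by rewrite muln0 addn0 sum_nat_const exp1n muln1.
- have [/existsP[FS /andP[cF nF]]|/existsPn nF] :=
    boolP [exists FS, clump_family e w r delta FS && (n <= 2 * #|cover FS|)].
    have [lb [p rtn]] := clump_routing cF nF; left.
    exists (fun v => w v + load lb p v), (fun t => if t == T then lb else lab t),
      (fun t => if t == T then p else pt t); split.
    + move=> t; rewrite ltnS leq_eqVlt; case: eqP => [_ _|_ /= tT]; first by exists w.
      exact: rt.
    + move=> v; rewrite big_ord_recr /= eqxx wE addnA; congr (_ + _ + _).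
      by apply: eq_bigr => t _; rewrite ltn_eqF.
    + by apply: leq_trans (load_energy rtn) _; move: wn; move: (n * r * delta) (\sum_v _) => a b; lia.
  right; exists w; split=> [v||FS cF].
  + by rewrite wE.
  + by apply: leq_trans wn _; rewrite leq_add2l leq_mul2l leqnSn orbT.
  + by rewrite ltnNge; have := nF FS; rewrite cF.
- right; exists w; split=> //.
  by apply: leq_trans wn _; rewrite leq_add2l leq_mul2l leqnSn orbT.
Qed.

(** [congestion] applied to the disjoint union of the [T] demand graphs, with edges [(t, x, y)]:
    degrees and multiplicities are at most those of one step times [T], and the congestion at [v] is
    at most [w v]. *)
Lemma run_long T : 0 < T -> run T ->
  n * r ^ 3 * T ^ 2 <= Xi * (n + 3 * (n * r * delta) * T).
Proof.
move=> T0 [w [lab [pt [rt wE wn]]]].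
pose E : {set 'I_T * V * V} := [set l : 'I_T * V * V | lab l.1.1 l.1.2 l.2].
have cardE (B : {set 'I_T * V * V}) (F : 'I_T -> V -> V -> bool) :
    (forall t x y, ((t, x, y) \in B) = F t x y) -> #|B| = \sum_(t < T) \sum_x \sum_y F t x y.
  by move=> H; rewrite card_triples; do 3 (apply: eq_bigr => ? _); rewrite H.
have key := @congestion V e e_sym h no_minor ('I_T * V * V)%type E 
  (fun l : 'I_T * V * V => l.1.2) (fun l : 'I_T * V * V => l.2)
  (fun l : 'I_T * V * V => pt l.1.1 l.1.2 l.2) q T.
have tsum (f : 'I_T -> nat) c : (forall t, f t <= c) -> \sum_t f t <= c * T.
  by move=> fc; rewrite mulnC -[X in X * _]card_ord -sum_nat_const leq_sum.
apply: leq_trans (key _ _ _ _ _ T0) _.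
- move=> [[t x] y]; rewrite inE /= => xy.
  by have [w' [H _ _ _ _]] := rt t (ltn_ord t); apply: H.
- move=> v; rewrite (cardE _ (fun t x y => lab t x y && (x == v))); last first.
    by move=> t x y; rewrite !inE.
  apply: tsum => t; have [w' [_ H _ _ _]] := rt t (ltn_ord t).
  rewrite (bigD1 v) //= [X in _ + X]big1 => [|x /negbTE xv].
    by rewrite addn0; apply: leq_trans (H v); apply: leq_sum => y _; rewrite eqxx andbT.
  by rewrite big1 // => y _; rewrite xv andbF.
- move=> v; rewrite (cardE _ (fun t x y => lab t x y && (y == v))); last first.
    by move=> t x y; rewrite !inE.
  apply: tsum => t; have [w' [_ _ H _ _]] := rt t (ltn_ord t).
  apply: leq_trans (H v); apply: leq_sum => x _.
  by rewrite (bigD1 v) //= eqxx andbT big1 ?addn0 // => y /negbTE ->; rewrite andbF.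
- move=> u v; rewrite (cardE _ (fun t x y => (lab t x y && (x == u)) && (y == v))); last first.
    by move=> t x y; rewrite !inE.
  rewrite -[leqRHS]mul1n; apply: tsum => t.
  rewrite (bigD1 u) //= [X in _ + X]big1 => [|x /negbTE xu]; last first.
    by rewrite big1 // => y _; rewrite xu andbF.
  rewrite addn0 (bigD1 v) //= !eqxx big1 ?addn0 ?leq_b1 // => y /negbTE ->.
  by rewrite andbF.
- rewrite (cardE _ (fun t x y => lab t x y)); last by move=> t x y; rewrite inE.
  rewrite mulnA mulnC -[X in X * _]card_ord -sum_nat_const big_distrr /=.
  by apply: leq_sum => t _; have [w' [_ _ _ H _]] := rt t (ltn_ord t).
rewrite leq_mul2l; apply/orP; right; apply: leq_trans wn; apply: leq_sum => v _.
rewrite leq_exp2r // wE (cardE _ (fun t x y => lab t x y && (v \in pt t x y))); last first.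
  by move=> t x y; rewrite !inE.
exact: leq_addl.
Qed.

Lemma spread_exists (D : nat) : 0 < n -> 0 < D -> delta = r ^ 2 * D ->
  exists w : V -> nat, [/\ forall v, 0 < w v,
    r * \sum_v w v ^ 2 <= 16 * Xi * n * delta ^ 2 &
    forall FS, clump_family e w r delta FS -> 2 * #|cover FS| < n].
Proof.
move=> n0 D0 dE.
have K00 : 0 < K0 by rewrite muln_gt0 addn1.
have r0 : 0 < r by rewrite muln_gt0 K00.
have X0 : 0 < Xi by rewrite muln_gt0 expn_gt0 addn_gt0 orbT.
(* With [delta = r ^ 2 * D] the two sides of [run_long] balance near [3 * D * Xi]; the surplus up to
   [4 * D * Xi] absorbs the starting term [n]. Stopping by then costs [12 * Xi * n * delta ^ 2], and
   [n] again fits into the remaining 4 of the 16. *)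
pose T := 4 * D * Xi; have T0 : 0 < T by rewrite /T muln_gt0 X0 andbT muln_gt0 D0.
have [rT|[w [w0 wn wF]]] := run_or_spread T.
  have := run_long T0 rT; rewrite dE leqNgt => /negP[].
  move: X0 r0 n0 D0 T0; rewrite /T; move: (Xi) (r) (n) => x k m x0 k0 m0 D0 T0.
  have big : 1 < k ^ 3 * D * (4 * D * x).
    have kD : 0 < k ^ 3 * D by rewrite muln_gt0 expn_gt0 k0.
    by move: kD; move: (k ^ 3 * D) => a; nia.
  have mx : 0 < m * x by rewrite muln_gt0 m0.
  by move: big; rewrite -(ltn_pmul2l mx) !expnS !expn0 !muln1; lia.
exists w; split=> //; apply: leq_trans (leq_mul (leqnn r) wn) _.
move: X0 r0 n0 D0 T0; rewrite dE /T; move: (Xi) (r) (n) => x k m x0 k0 m0 D0 T0.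
have big : 0 < k ^ 3 * D * (4 * D * x) by rewrite muln_gt0 muln_gt0 expn_gt0 k0 D0.
have := leq_mul (leqnn (k * m)) big; rewrite !expnS !expn0 !muln1; lia.
Qed.

End Process.

(** * Weighted distances and the Klein-Plotkin-Rao argument *)

Section Levels.
Context (V : finType) (e : rel V) (e_sym : symmetric e) (w : V -> nat).

Implicit Types (Z P : {set V}) (k : nat) (x y u v z : V).

Local Notation wt := (weight w).
Local Notation near := (near e w).

Lemma wtS (A B : {set V}) : A \subset B -> wt A <= wt B.
Proof.
move=> /subsetP AB; rewrite /weight big_mkcond [leqRHS]big_mkcond; apply: leq_sum => v _.
by case: ifP => // /AB ->.
Qed.

Lemma wtU (A B : {set V}) : wt (A :|: B) <= wt A + wt B.
Proof.
rewrite /weight big_mkcond [X in _ <= X + _]big_mkcond [X in _ <= _ + X]big_mkcond -big_split.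
by apply: leq_sum => v _; rewrite inE; case: (v \in A); case: (v \in B); rewrite //= ?leq_addr.
Qed.

Lemma near_sym Z k x y : near Z k x y = near Z k y x.
Proof. by apply/nearP/nearP => -[P [? ? ? ? ?]]; exists P. Qed.

Lemma near_refl Z x : x \in Z -> near Z (w x) x x.
Proof.
move=> xZ; apply/nearP; exists [set x]; rewrite sub1set conn1 !inE eqxx.
by split=> //; rewrite /weight big_set1.
Qed.

Lemma near_mono Z Z' k k' x y : Z \subset Z' -> k <= k' -> near Z k x y -> near Z' k' x y.
Proof.
move=> ZZ' kk' /nearP[P [PZ ? ? ? Pk]]; apply/nearP; exists P; split=> //.
  exact: subset_trans ZZ'.
exact: leq_trans kk'.
Qed.

Lemma near_trans Z k l x y z : near Z k x y -> near Z l y z -> near Z (k + l) x z.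
Proof.
move=> /nearP[P [PZ cP xP yP Pk]] /nearP[Q [QZ cQ yQ zQ Ql]].
apply/nearP; exists (P :|: Q); split; rewrite ?subUset ?PZ ?inE ?xP ?zQ ?orbT //.
  by apply: connU => //; apply/pred0Pn; exists y; apply/andP.
exact: leq_trans (wtU _ _) (leq_add _ _).
Qed.

Lemma near_in Z k x y : near Z k x y -> x \in Z /\ y \in Z.
Proof. by move=> /nearP[P [/subsetP PZ _ xP yP _]]; split; apply: PZ. Qed.

Lemma near_conn (Z P : {set V}) k x y : P \subset Z -> conn e P -> x \in P -> y \in P ->
  wt P <= k -> near Z k x y.
Proof. by move=> *; apply/nearP; exists P. Qed.

(** The w-distance from [x] inside [Z]. A distance never exceeds [wt setT], so the search range
    suffices, and unreachable vertices get [(wt setT).+1]. *)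
Definition lev (Z : {set V}) (x v : V) : nat :=
  find (fun k => near Z k x v) (iota 0 (wt setT).+1).

Lemma lev_le Z k x v : near Z k x v -> lev Z x v <= k.
Proof.
move=> xv; rewrite leqNgt; apply/negP => kl.
have := @before_find _ 0 (fun k => near Z k x v) _ _ kl.
rewrite nth_iota ?add0n ?xv //; apply: leq_trans kl _.
by rewrite /lev (leq_trans (find_size _ _)) // size_iota.
Qed.

Lemma near_lev Z k x v : near Z k x v -> near Z (lev Z x v) x v.
Proof.
move=> /nearP[P [PZ cP xP vP _]].
have hs : has (fun k => near Z k x v) (iota 0 (wt setT).+1).
  apply/hasP; exists (wt setT); first by rewrite mem_iota add0n ltnS leqnn.
  by apply: near_conn PZ cP xP vP _; apply/wtS/subsetT.
have := nth_find 0 hs; rewrite nth_iota ?add0n //.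
by move: hs; rewrite has_find size_iota.
Qed.

Context (Z : {set V}) (x : V).
Hypothesis w_gt0 : forall v, 0 < w v.
Hypothesis cZ : conn e Z.
Hypothesis xZ : x \in Z.
Local Notation level := (lev Z x).

Lemma near_level v : v \in Z -> near Z (level v) x v.
Proof. by move=> vZ; apply: (@near_lev _ (wt Z)); apply: near_conn (leqnn _). Qed.

Lemma level_root : level x <= w x.
Proof. by apply: lev_le; apply: near_refl. Qed.

Lemma level_near k u v : near Z k u v -> level v <= level u + k.
Proof.
move=> uv; have [uZ vZ] := near_in uv; apply: lev_le.
exact: near_trans (near_level uZ) uv.
Qed.

Lemma level_edge u v : u \in Z -> v \in Z -> e u v -> level v <= level u + w v.
Proof.
move=> uZ vZ uv; apply: lev_le; have /nearP[P [PZ cP xP uP Pk]] := near_level uZ.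
apply/nearP; exists (P :|: [set v]); rewrite subUset PZ sub1set vZ !inE xP eqxx orbT.
split=> //; first by apply: connU_touch (conn1 _ _) _ => //; apply/touchP; exists u, v; rewrite inE.
by apply: leq_trans (wtU _ _) _; rewrite /weight big_set1 leq_add2r.
Qed.

(** Remove [v] from a cheapest connected set joining [x] to [v]: the component of [x] contains a
    neighbour of [v] and is cheaper by at least [w v]. *)
Lemma level_parent v : v \in Z -> v != x ->
  exists u, [/\ u \in Z, e u v & level v = level u + w v].
Proof.
move=> vZ vx; have /nearP[P [PZ cP xP vP Pk]] := near_level vZ.
have xv : x \notin [set v] by rewrite inE eq_sym.
have /touchP[u [y [uC /set1P -> uv]]] := component_touch cP xP xv vP (set11 v).
have xD : x \in P :\: [set v] by rewrite in_setD xv.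
have uP := subsetP (component_sub e xD) _ uC.
have uZ : u \in Z by apply: (subsetP PZ); move: uP; rewrite inE => /andP[].
exists u; split=> //; apply/eqP; rewrite eqn_leq level_edge //=.
have lu : level u <= wt (component e (P :\: [set v]) x).
  apply: lev_le; apply: near_conn (conn_component _ _ _) (component_refl _ _ _) uC (leqnn _) => //.
  exact: subset_trans (component_sub e xD) (subset_trans (subsetDl _ _) PZ).
apply: leq_trans Pk; rewrite /weight (big_setD1 v) //= addnC leq_add2l.
by apply: leq_trans lu _; apply: wtS (component_sub e xD).
Qed.

Lemma conn_ball b : conn e [set u in Z | level u <= b].
Proof.
apply: (@conn_from _ _ e_sym x) => u; rewrite inE => /andP[uZ ub].
have /nearP[P [PZ /connP cP xP uP Pk]] := near_level uZ.
apply: connect_withinS (cP _ _ xP uP); apply/subsetP => y yP.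
rewrite inE (subsetP PZ) //=; apply: leq_trans ub; apply: leq_trans Pk.
by apply: lev_le; apply: near_conn (leqnn _) => //; apply/connP.
Qed.

(* T is a geodesic from v towards x, cut off at level b; S is its initial segment
   up to u. *)
Lemma tail b v : level x <= b -> v \in Z -> b < level v ->
  exists (T : {set V}) (t z : V),
  [/\ [/\ T \subset Z, conn e T, v \in T & {in T, forall u, b < level u <= level v}],
      [/\ t \in T, z \in Z, e t z, level z <= b & b < level z + w t] &
      {in T, forall u, exists S : {set V}, [/\ S \subset T, conn e S, v \in S, u \in S &
         {in S, forall s, level u <= level s} /\ wt S + level u <= level v + w u]}].
Proof.
move=> xb; have [m] := ubnP (level v); elim: m v => // m IH v /ltnSE-vm vZ bv.
have vx : v != x by apply: contraTneq bv => ->; rewrite -leqNgt.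
have [u [uZ uv vu]] := level_parent vZ vx.
have sv : wt [set v] = w v by rewrite /weight big_set1.
have self : exists S : {set V}, [/\ S \subset [set v], conn e S, v \in S, v \in S &
         {in S, forall s, level v <= level s} /\ wt S + level v <= level v + w v].
  exists [set v]; rewrite conn1 set11; split=> //; split; last by rewrite sv addnC.
  by move=> s /set1P ->.
have [ub|bu] := leqP (level u) b.
  exists [set v], v, u; split.
  - by rewrite sub1set vZ conn1 set11; split=> // y /set1P ->; rewrite bv leqnn.
  - by rewrite set11 e_sym -vu.
  - by move=> y /set1P ->.
have [|T [t [z [[TZ cT uT Tl] tz TS]]]] := IH u _ uZ bu.
  by move: (w_gt0 v) vm; rewrite vu; lia.
exists (v |: T), t, z; split.
- rewrite setU11 subUset sub1set vZ TZ; split=> //.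
    by apply: connU_touch => //; [apply: conn1 | apply/touchP; exists v, u; rewrite set11 e_sym].
  move=> y /setU1P[->|/Tl/andP[by_ yu]]; first by rewrite bv leqnn.
  by rewrite by_ vu (leq_trans yu) ?leq_addr.
- by case: tz => tT zZ etz zb bz; split=> //; rewrite inE tT orbT.
move=> y /setU1P[->|yT].
  have [S [SS ? ? ? ?]] := self; exists S; split=> //.
  exact: subset_trans SS (subsetUl _ _).
have [S [ST cS uS yS [Sl Sw]]] := TS y yT.
exists (v |: S); rewrite setU11 !inE yS orbT setUS //; split=> //.
  by apply: connU_touch => //; [apply: conn1 | apply/touchP; exists v, u; rewrite set11 e_sym].
split=> [s /setU1P[->|/Sl //]|].
  by have /andP[_ yu] := Tl y yT; rewrite vu (leq_trans yu) ?leq_addr.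
apply: leq_trans (leq_add (wtU [set v] S) (leqnn _)) _; rewrite sv -addnA vu.
by apply: leq_trans (leq_add (leqnn _) Sw) _; rewrite addnA [w v + _]addnC.
Qed.

End Levels.

Ltac nlia := repeat match goal with H : ?P |- _ => match type of P with Prop => clear H end end; lia.

(** * Clique models in nested slabs *)

Section KPR.
Context (V : finType) (e : rel V) (e_sym : symmetric e) (w : V -> nat).
Hypothesis w_gt0 : forall v, 0 < w v.
Context (h tau : nat).
Hypothesis tau_gt0 : 0 < tau.
Local Notation near := (near e w).

(* A clique model with m branch sets inside Z, together with h points that are
   far apart in the whole graph; the j-th point represents the j-th branch set
   and is, in the intrinsic metric of Z, away from the other branch sets. *)
Definition rooted_model (Z : {set V}) (m D : nat) : Prop :=
  exists (c : 'I_h -> V) (B : 'I_h -> {set V}),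
  [/\ forall j, c j \in Z,
      forall j l, j != l -> ~~ near setT D (c j) (c l),
      forall j : 'I_h, j < m -> [/\ B j \subset Z, conn e (B j) & c j \in B j],
      forall j l : 'I_h, j < m -> l < m -> j != l -> [disjoint B j & B l] /\ touch e (B j) (B l) &
      forall j l : 'I_h, j < m -> l < m -> j != l ->
        {in B l, forall u, ~~ near Z (2 * tau) (c j) u}].

(* The Klein-Plotkin-Rao step for a component Q of a slab of Z.  The new branch
   set is the ball C around the root x; every old branch set is extended by a
   geodesic tail towards x until it reaches C.  A tail meets Q only in an initial
   segment, which is short in Q itself, so it avoids the other branch sets.  The
   representatives move to points below the slab. *)
Lemma rooted_model_step (Z Q : {set V}) (x : V) (a a' m D : nat) :
  conn e Z -> x \in Z -> {in Z, forall u, w u <= tau} -> a' <= a + tau ->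
  Q \subset Z -> {in Q, forall u, a <= lev e w Z x u < a'} ->
  (forall u v, u \in Q -> v \in Z -> a <= lev e w Z x v < a' -> e u v -> v \in Q) ->
  1 < h -> m < h -> rooted_model Q m (D + 24 * tau) -> rooted_model Z m.+1 D.
Proof.
move=> cZ xZ wt ba QZ Qlb Qcl h1 mh [c [B [cQ cfar Bp Bd Bfar]]].
have Ql : {in Q, forall u, a <= lev e w Z x u < a + tau}.
  by move=> u /Qlb /andP[-> /leq_trans ->].
have sT (A : {set V}) : A \subset [set: V] by apply: subsetT.
have cZ' j : c j \in Z by apply: (subsetP QZ).
have nearx v : v \in Z -> near Z ((lev e w Z x) v) x v by move=> vZ; apply: near_level.
have lx : (lev e w Z x) x <= tau by apply: leq_trans (level_root e w xZ) (wt x xZ).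
have far k j l : k <= D + 24 * tau -> j != l -> near Z k (c j) (c l) -> False.
  move=> kD jl njl; have /negP := cfar j l jl; apply.
  exact: near_mono njl.
have a9 : 9 * tau <= a.
  rewrite leqNgt; apply/negP => a9; pose i0 := Ordinal (ltnW h1); pose i1 := Ordinal h1.
  have i01 : i0 != i1 by [].
  have /andP[_ l0] := Ql _ (cQ i0); have /andP[_ l1] := Ql _ (cQ i1).
  apply: (far ((lev e w Z x) (c i0) + (lev e w Z x) (c i1)) i0 i1) => //; first by move: l0 l1 a9; nlia.
  by apply: (near_trans e_sym _ (nearx _ (cZ' i1))); rewrite near_sym; apply: nearx.
(* Layout below the slab: [T1] leads to [z] between levels [a - 4 * tau] and [a - 3 * tau], [T2]
   continues to the top [a - 6 * tau] of the ball [C], and [zm] lies at most at [a - 8 * tau]. The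
   gaps from [z] to [Q] and to [C], and from [zm] to the other branch sets, exceed [2 * tau]. No
   representative moves by more than [12 * tau], whence the [24 * tau]. *)
have tail1 j : exists (T : {set V}) z,
   [/\ [/\ T \subset Z, conn e T, c j \in T & {in T, forall u, a - 3 * tau < (lev e w Z x) u}],
       [/\ touch e T [set z], z \in Z & a - 4 * tau < (lev e w Z x) z <= a - 3 * tau],
       {in T, forall u, near Z (5 * tau) (c j) u}, near Z (7 * tau) (c j) z &
       {in T, forall u, u \in Q -> near Q (2 * tau) (c j) u}].
  have /andP[la lt] := Ql _ (cQ j).
  have [||T [t [z [[TZ cT cjT Tl] [tT zZ etz zb bz] TS]]]] :=
    @tail _ e e_sym w Z x w_gt0 cZ xZ (a - 3 * tau) (c j) _ (cZ' j).
  - by move: lx a9; nlia.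
  - by move: la tau_gt0 a9; nlia.
  have nT u : u \in T -> near Z (5 * tau) (c j) u.
    move=> uT; have [S [ST cS vS uS [_ Sw]]] := TS u uT.
    apply: (near_conn (P := S)) => //; first exact: subset_trans ST TZ.
    by have /andP[lu _] := Tl u uT; move: Sw lu lt (wt u (subsetP TZ _ uT)); nlia.
  exists T, z; split=> //.
  - by split=> // u /Tl /andP[].
  - split=> //; first by apply/touchP; exists t, z; rewrite set11.
    by rewrite zb andbT; move: bz a9 (wt t (subsetP TZ _ tT)); nlia.
  - have -> : 7 * tau = 5 * tau + 2 * tau by rewrite -mulnDl.
    apply: (near_trans e_sym (nT t tT)); apply: (near_conn (P := [set t] :|: [set z])).
    + by rewrite subUset !sub1set zZ (subsetP TZ).
    + by apply: connU_touch (conn1 _ _) (conn1 _ _) _ => //; apply/touchP; exists t, z; rewrite !set11.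
    + by rewrite inE set11.
    + by rewrite inE set11 orbT.
    apply: leq_trans (wtU _ _ _) _; rewrite /weight !big_set1.
    by move: (wt t (subsetP TZ _ tT)) (wt z zZ); nlia.
  - move=> u uT uQ; have [S [ST cS vS uS [Sl Sw]]] := TS u uT.
    have /andP[au _] := Ql u uQ.
    apply: (near_conn (P := S)) => //; last first.
      by move: Sw au lt (wt u (subsetP TZ _ uT)); nlia.
    (* The segment [S] starts in [Q] and has levels between those of [u] and [c j], hence inside the
       slab; [Q] is closed under edges of [Z] within the slab, so [S] never leaves it and the bound
       holds in the metric of [Q]. *)
    apply/subsetP => s sS; have /connP cS' := cS.
    apply: connect_stable (cS' _ _ vS sS) (cQ j) => y y' yQ /and3P[yy' _ y'S].
    apply: (Qcl y) => //; first by apply: (subsetP TZ); apply: (subsetP ST).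
    have /andP[_ y'l] := Tl y' (subsetP ST _ y'S); have /andP[_ ltb] := Qlb _ (cQ j).
    by rewrite (leq_trans au) ?Sl //= (leq_ltn_trans y'l).
have /fin_all_exists[T1 /fin_all_exists[z zP]] := tail1.
have tail2 b v : tau <= b -> v \in Z -> b < (lev e w Z x) v -> exists (T : {set V}) y,
   [/\ [/\ T \subset Z, conn e T, v \in T & {in T, forall u, b < (lev e w Z x) u <= (lev e w Z x) v}],
       touch e T [set y], y \in Z /\ (lev e w Z x) y <= b &
       {in T, forall u, near Z ((lev e w Z x) v - b + tau) v u} /\ near Z ((lev e w Z x) v - b + 3 * tau) v y].
  move=> tb vZ bv.
  have [||T [t [y [[TZ cT cjT Tl] [tT yZ ety yb by_] TS]]]] :=
    @tail _ e e_sym w Z x w_gt0 cZ xZ b v _ vZ => //; first exact: leq_trans lx tb.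
  have nT u : u \in T -> near Z ((lev e w Z x) v - b + tau) v u.
    move=> uT; have [S [ST cS vS uS [_ Sw]]] := TS u uT.
    apply: (near_conn (P := S)) => //; first exact: subset_trans ST TZ.
    by have /andP[lu _] := Tl u uT; move: Sw lu bv (wt u (subsetP TZ _ uT)); nlia.
  exists T, y; split=> //; first by apply/touchP; exists t, y; rewrite set11.
  split=> //.
  have -> : (lev e w Z x) v - b + 3 * tau = (lev e w Z x) v - b + tau + 2 * tau by nlia.
  apply: (near_trans e_sym (nT t tT)); apply: (near_conn (P := [set t] :|: [set y])).
  + by rewrite subUset !sub1set yZ (subsetP TZ).
  + by apply: connU_touch (conn1 _ _) (conn1 _ _) _ => //; apply/touchP; exists t, y; rewrite !set11.
  + by rewrite inE set11.
  + by rewrite inE set11 orbT.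
  apply: leq_trans (wtU _ _ _) _; rewrite /weight !big_set1.
  by move: (wt t (subsetP TZ _ tT)) (wt y yZ); nlia.
pose C := [set u in Z | (lev e w Z x) u <= a - 6 * tau].
have cC : conn e C by apply: (conn_ball e_sym).
have lowtail j : exists T : {set V},
   [/\ T \subset Z, conn e T /\ z j \in T, {in T, forall u, a - 6 * tau < (lev e w Z x) u <= a - 3 * tau},
       touch e T C & {in T, forall u, near Z (11 * tau) (c j) u}].
  have [_ [_ zZ /andP[z4 z3]] _ nz _] := zP j.
  have [||T [y [[TZ cT zT Tl] tTy [yZ yb] [nT _]]]] := @tail2 (a - 6 * tau) (z j) _ zZ.
  - by move: a9; nlia.
  - by move: z4 a9 tau_gt0; nlia.
  exists T; split=> //.
  - by move=> u /Tl /andP[-> /leq_trans -> //].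
  - by apply: touchS tTy => //; rewrite sub1set inE yZ.
  - move=> u uT; have -> : 11 * tau = 7 * tau + 4 * tau by rewrite -mulnDl.
    apply: (near_trans e_sym nz); by apply: near_mono (nT u uT) => //; move: z3 a9; nlia.
have /fin_all_exists[T2 T2P] := lowtail.
have [zm [zmZ zml nzm]] : exists y, [/\ y \in Z, (lev e w Z x) y <= a - 8 * tau &
    near Z (12 * tau) (c (Ordinal mh)) y].
  have /andP[la lt] := Ql _ (cQ (Ordinal mh)).
  have [||T [y [_ _ [yZ yb] [_ ny]]]] := @tail2 (a - 8 * tau) _ _ (cZ' (Ordinal mh)).
  - by move: a9; nlia.
  - by move: la a9 tau_gt0; nlia.
  by exists y; split=> //; apply: near_mono ny => //; move: lt a9; nlia.
pose B' (j : 'I_h) := if j < m then B j :|: (T1 j :|: T2 j) else C.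
pose c' (j : 'I_h) := if j < m then z j else if j == m :> nat then zm else c j.
have nc' j : near Z (12 * tau) (c j) (c' j).
  rewrite /c'; case: ifP => [jm|_].
    by have [_ _ _ nz _] := zP j; apply: near_mono nz => //; nlia.
  case: eqP => [jm|_]; first by have -> : j = Ordinal mh by apply: val_inj.
  by apply: near_mono (near_refl e w (cZ' j)) => //; move: (wt _ (cZ' j)); nlia.
have nT j u : u \in T1 j :|: T2 j -> near Z (11 * tau) (c j) u.
  case/setUP => [uT|uT]; last by have [_ _ _ _] := T2P j; apply.
  by have [_ _ n5 _ _] := zP j; apply: near_mono (n5 u uT) => //; nlia.
have cTj j : conn e (T1 j :|: T2 j).
  have [[_ cT1 _ _] [tT1 _ _] _ _ _] := zP j; have [_ [cT2 zT2] _ _ _] := T2P j.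
  by apply: connU_touch => //; apply: touchS tT1 => //; rewrite sub1set.
have TQ j u : u \in T1 j :|: T2 j -> u \in Q -> near Q (2 * tau) (c j) u.
  case/setUP => [uT|uT] uQ; first by have [_ _ _ _] := zP j; apply.
  have [_ _ T2l _ _] := T2P j; have /andP[_ u3] := T2l u uT.
  by have /andP[ua _] := Ql u uQ; move: u3 ua a9 tau_gt0; nlia.
have TZ j : T1 j :|: T2 j \subset Z.
  by have [[T1Z _ _ _] _ _ _ _] := zP j; have [T2Z _ _ _ _] := T2P j; rewrite subUset T1Z.
have Blev (j : 'I_h) u : j < m -> u \in B' j -> a - 6 * tau < (lev e w Z x) u.
  rewrite /B' => jm; rewrite jm => /setUP[uB|/setUP[uT|uT]].
  - have [BQ _ _] := Bp j jm; have /andP[ua _] := Ql u (subsetP BQ _ uB).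
    by move: ua a9 tau_gt0; nlia.
  - by have [[_ _ _ T1l] _ _ _ _] := zP j; move: (T1l u uT) a9 tau_gt0; nlia.
  - by have [_ _ T2l _ _] := T2P j; have /andP[] := T2l u uT.
exists c', B'; split.
- by move=> j; have [] := near_in (nc' j).
- move=> j l jl; apply/negP => njl; have /negP := cfar j l jl; apply.
  have -> : D + 24 * tau = 12 * tau + (D + 12 * tau) by nlia.
  apply: (near_trans e_sym (near_mono (sT _) (leqnn _) (nc' j))).
  apply: (near_trans e_sym njl); rewrite near_sym.
  exact: near_mono (sT _) (leqnn _) (nc' l).
- move=> j; rewrite ltnS leq_eqVlt /B' /c' => /orP[/eqP jm|jm].
    rewrite jm ltnn eqxx; split=> //.
      by apply/subsetP => u; rewrite inE => /andP[].
    by rewrite inE zmZ /=; by move: zml; nlia.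
  rewrite jm; have [BQ cB cjB] := Bp j jm; split.
  + by rewrite subUset TZ (subset_trans BQ QZ).
  + apply: connU => //; apply/pred0Pn; exists (c j); rewrite /= cjB inE.
    by have [[_ _ -> _] _ _ _ _] := zP j.
  + by have [_ [_ zT2] _ _ _] := T2P j; rewrite !inE zT2 !orbT.
- have dC (j : 'I_h) : j < m -> [disjoint B' j & C] /\ touch e (B' j) C.
    move=> jm; split.
      apply/pred0P => u /=; apply/negP => /andP[/(Blev j u jm) uB].
      by rewrite inE => /andP[_]; rewrite leqNgt uB.
    have [_ _ _ tC _] := T2P j; rewrite /B' jm; apply: touchS tC => //.
    by rewrite setUA subsetUr.
  move=> j l; rewrite !ltnS => jm lm jl.
  have [jm'|mj] := ltnP j m; have [lm'|ml] := ltnP l m.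
  + have [dB tB] := Bd j l jm' lm' jl; rewrite /B' jm' lm'; split; last first.
      by apply: touchS tB; rewrite subsetUl.
    have BT (i i' : 'I_h) u : i < m -> i' < m -> i != i' -> u \in B i -> u \in T1 i' :|: T2 i' -> False.
      move=> im i'm ii' uB uT; have [BQ _ _] := Bp i im.
      rewrite eq_sym in ii'; have /negP := Bfar i' i i'm im ii' u uB; apply.
      by apply: TQ uT _; apply: (subsetP BQ).
    apply/pred0P => u /=; apply/negP => /andP[/setUP[uB|uT] /setUP[uB'|uT']].
    * by have /pred0P/(_ u) := dB; rewrite /= uB uB'.
    * exact: (BT j l u).
    * by apply: (BT l j u) => //; rewrite eq_sym.
    * apply: (far (11 * tau + 11 * tau) j l) => //; first by nlia.
      by apply: (near_trans e_sym (nT j u uT)); rewrite near_sym; apply: nT.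
  + have -> : B' l = C by rewrite /B' ltnNge ml.
    exact: dC.
  + have -> : B' j = C by rewrite /B' ltnNge mj.
    by rewrite disjoint_sym touchC //; apply: dC.
  + by case/eqP: jl; apply: val_inj => /=; move: jm lm mj ml; nlia.
move=> j l; rewrite !ltnS => jm lm jl u uB; apply/negP => nju.
have lju : (lev e w Z x) (c' j) <= (lev e w Z x) u + 2 * tau by apply: (level_near e_sym cZ xZ); rewrite near_sym.
have luj : (lev e w Z x) u <= (lev e w Z x) (c' j) + 2 * tau by apply: (level_near e_sym cZ xZ).
have [jm'|mj] := ltnP j m; have [lm'|ml] := ltnP l m.
- have c'j : c' j = z j by rewrite /c' jm'.
  have [_ [_ _ /andP[_ z3]] _ nz _] := zP j; rewrite c'j in lju luj nju.
  move: uB; rewrite /B' lm' => /setUP[uB|uT].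
    have [BQ _ _] := Bp l lm'; have /andP[ua _] := Ql u (subsetP BQ _ uB).
    by move: ua luj z3 a9 tau_gt0; nlia.
  apply: (far (7 * tau + (2 * tau + 11 * tau)) j l) => //; first by nlia.
  apply: (near_trans e_sym nz); apply: (near_trans e_sym nju); rewrite near_sym; exact: nT.
- have [_ [_ _ /andP[z4 _]] _ _ _] := zP j.
  by move: uB lju; rewrite /B' /c' jm' ltnNge ml /= inE => /andP[_ u6] lju; move: u6 lju z4 a9 tau_gt0; nlia.
- have jm' : j == m :> nat by rewrite eqn_leq jm.
  have := Blev l u lm' uB; move: luj; rewrite /c' ltnNge mj jm' /= => luj u6.
  by move: zml luj u6 a9 tau_gt0; nlia.
- by case/eqP: jl; apply: val_inj => /=; move: jm lm mj ml; nlia.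
Qed.

Lemma rooted_model_minor Z D : rooted_model Z h D -> clique_minor e h.
Proof.
move=> [c [B [_ _ Bp Bd _]]]; exists B; split=> [i|i j ij|i|i j ij].
- by have [_ _ ci] := Bp i (ltn_ord i); apply/set0Pn; exists (c i).
- by have [] := Bd i j (ltn_ord i) (ltn_ord j) ij.
- by have [] := Bp i (ltn_ord i).
- by have [] := Bd i j (ltn_ord i) (ltn_ord j) ij.
Qed.

End KPR.

(** * Slicing *)

Lemma subset_of_card (T : finType) (A : {set T}) (k : nat) :
  k <= #|A| -> exists2 B : {set T}, B \subset A & #|B| = k.
Proof.
move=> kA; exists [set x in take k (enum A)].
  by apply/subsetP => x; rewrite inE => /mem_take; rewrite mem_enum.
rewrite cardsE; have /card_uniqP -> : uniq (take k (enum A)) by rewrite take_uniq // enum_uniq.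
by rewrite size_takel // -cardE.
Qed.

Section Chops.
Context (V : finType) (e : rel V) (e_sym : symmetric e) (w : V -> nat).
Hypothesis w_gt0 : forall v, 0 < w v.
Context (tau : nat).
Hypothesis tau_gt0 : 0 < tau.
Local Notation near := (near e w).
Local Notation light v := (w v <= tau).

Definition light_edge : rel V := [rel u v | [&& e u v, light u & light v]].

Definition cls (r : rel V) (v : V) : {set V} := [set u | connect r v u].

Definition height (r : rel V) (v : V) : nat := lev e w (cls r v) (fingraph.root r v) v.

Definition chop (o : nat) (r : rel V) : rel V :=
  [rel u v | r u v && ((height r u + o) %/ tau == (height r v + o) %/ tau)].

(** A partition stored as its relation of uncut edges. Heavy vertices are isolated, and the last
    clause makes each class of light vertices an induced subgraph, so that connectivity and distance
    in [cls r v] can be taken with respect to [e]. *)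
Definition slicing (r : rel V) : Prop :=
  [/\ symmetric r, subrel r light_edge &
      forall u v, light u -> connect r u v -> e u v -> r u v].

Lemma connect_light r u v : slicing r -> connect r u v -> light u -> light v.
Proof.
move=> [_ sub _] uv lu; have : v \in [set y | light y].
  apply: connect_stable uv _; last by rewrite inE.
  by move=> a b _ /sub/and3P[_ _ lb]; rewrite inE.
by rewrite inE.
Qed.

Lemma slicing_light : slicing light_edge.
Proof.
split=> // [u v|u v lu uv euv].
  by rewrite /light_edge /= e_sym [light u && _]andbC.
rewrite /light_edge /= euv lu /=.
have : v \in [set y | light y].
  apply: connect_stable uv _; last by rewrite inE.
  by move=> a b _ /and3P[_ _ lb]; rewrite inE.
by rewrite inE.
Qed.

Lemma slicing_sym r : slicing r -> connect_sym r.
Proof. by move=> [sr _ _]; apply: sym_connect_sym. Qed.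

Lemma cls_eq r u v : slicing r -> connect r u v -> cls r u = cls r v.
Proof.
move=> sl uv; apply/setP => y; rewrite !inE.
exact: (same_connect (slicing_sym sl)).
Qed.

Lemma root_eq r u v : slicing r -> connect r u v -> fingraph.root r u = fingraph.root r v.
Proof. by move=> sl uv; apply/eqP; rewrite root_connect //; apply: slicing_sym. Qed.

Lemma conn_cls r v : slicing r -> conn e (cls r v).
Proof.
move=> sl; have [_ sub _] := sl; apply: (@conn_from _ e e_sym v) => x; rewrite inE => vx.
suff : x \in [set y | connect r v y && connect (within e (cls r v)) v y].
  by rewrite inE => /andP[].
apply: connect_stable vx _; last by rewrite inE !connect0.
move=> a b; rewrite inE => /andP[va wa] ab.
have vb : connect r v b by apply: connect_trans va (connect1 ab).
rewrite inE vb; apply: connect_trans wa (connect1 _).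
by rewrite /within /= !inE va vb !andbT; have /and3P[] := sub _ _ ab.
Qed.

Lemma chop_sub o r : subrel (chop o r) r.
Proof. by move=> u v /andP[]. Qed.

Lemma connect_chop o r u v : connect (chop o r) u v ->
  connect r u v /\ (height r u + o) %/ tau = (height r v + o) %/ tau.
Proof.
move=> uv; split.
  by apply: connect_sub uv => a b /chop_sub/connect1.
have : v \in [set y | (height r u + o) %/ tau == (height r y + o) %/ tau].
  apply: connect_stable uv _; last by rewrite inE.
  by move=> a b; rewrite !inE => /eqP -> /andP[_].
by rewrite inE => /eqP.
Qed.

Lemma slicing_chop o r : slicing r -> slicing (chop o r).
Proof.
move=> [sr sub ind]; split.
- by move=> u v; rewrite /chop /= sr eq_sym.
- by move=> u v /chop_sub/sub.
- by move=> u v lu /connect_chop[uv auv] euv; rewrite /chop /= ind // auv eqxx.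
Qed.

Lemma height_edge r u v : slicing r -> r u v -> height r v <= height r u + w v.
Proof.
move=> sl ruv; have [sr sub _] := sl; have uv := connect1 ruv.
have rootc : fingraph.root r u \in cls r u by rewrite inE connect_root.
rewrite /height -(cls_eq sl uv) -(root_eq sl uv).
apply: (level_edge e_sym w (conn_cls u sl) rootc); rewrite ?inE ?connect0 //.
by have /and3P[] := sub _ _ ruv.
Qed.

(** Distance from the shifted height to the nearest multiple of [tau], that is, to the nearest
    cut. *)
Definition margin (o : nat) (r : rel V) (v : V) : nat :=
  minn ((height r v + o) %% tau) (tau - (height r v + o) %% tau).

Lemma margin_lipschitz d a b : a <= b + d -> b <= a + d -> a %/ tau = b %/ tau ->
  minn (a %% tau) (tau - a %% tau) <= minn (b %% tau) (tau - b %% tau) + d.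
Proof.
move=> ab ba q; rewrite (divn_eq a tau) (divn_eq b tau) q in ab ba.
move: (b %/ tau * tau) ab ba => c; move: (a %% tau) (b %% tau) => s t; clear; lia.
Qed.

Lemma margin_cross d a b : a <= b + d -> b <= a + d -> a %/ tau != b %/ tau ->
  minn (a %% tau) (tau - a %% tau) <= d.
Proof.
move=> ab ba; rewrite neq_ltn => /orP[q|q].
  apply: leq_trans (geq_minr _ _) _.
  have := leq_mul q (leqnn tau); rewrite mulSn => qq.
  by move: ba; rewrite {1}(divn_eq a tau) {1}(divn_eq b tau); have := ltn_pmod a tau_gt0; move: qq; clear; lia.
apply: leq_trans (geq_minl _ _) _.
have := leq_mul q (leqnn tau); rewrite mulSn => qq.
move: ab; rewrite {1}(divn_eq a tau) {1}(divn_eq b tau); have := ltn_pmod b tau_gt0; move: qq; clear; lia.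
Qed.

Context (rho : nat).
Hypothesis rho_tau : rho <= tau.

(** The bound on cut edges lets [f] be replaced by 0 on any set of classes: the jump then created is
    no larger than the slope allowed on uncut edges. *)
Definition cutoff (r : rel V) (f : V -> nat) : Prop :=
  [/\ forall v, f v <= rho, forall v, ~~ light v -> f v = 0 &
      forall u v, e u v -> if r u v then f u <= f v + (w u + w v) else f u <= w u + w v].

Definition light_cutoff (v : V) : nat := if light v then rho else 0.

(** An edge with a heavy end may carry a jump larger than [tau], hence the full drop from [rho] to
    0. *)
Lemma cutoff_light : cutoff light_edge light_cutoff.
Proof.
rewrite /light_cutoff; split=> [v|v /negbTE -> //|u v uv]; first by case: ifP.
rewrite /light_edge /= uv /=; case: (leqP (w u) tau) => //= _.
case: leqP => [_|lv]; first exact: leq_addr.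
by apply: leq_trans rho_tau _; apply: leq_trans (ltnW lv) _; apply: leq_addl.
Qed.

Lemma cutoff_chop o r f : slicing r -> cutoff r f ->
  cutoff (chop o r) (fun v => minn (f v) (margin o r v)).
Proof.
move=> sl [f1 f2 f3]; have [sr _ _] := sl; split=> [v|v lv|u v uv].
- exact: leq_trans (geq_minl _ _) (f1 v).
- by rewrite f2 // min0n.
have := f3 u v uv; rewrite /chop /=; case: ifP => ruv /= fuv; last first.
  exact: leq_trans (geq_minl _ _) fuv.
have huv : height r u + o <= height r v + o + (w u + w v).
  by rewrite addnAC leq_add2r; apply: leq_trans (height_edge sl _) _; [rewrite sr; exact: ruv | rewrite leq_add2l leq_addr].
have hvu : height r v + o <= height r u + o + (w u + w v).
  by rewrite addnAC leq_add2r; apply: leq_trans (height_edge sl ruv) _; rewrite leq_add2l leq_addl.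
case: ifP => [/eqP q|/negbT q].
  have := margin_lipschitz huv hvu q; rewrite /margin; move: fuv; clear.
  by move: (minn (_ %% _) _) (minn (_ %% _) _) (f u) (f v) (w u + w v); lia.
by apply: leq_trans (geq_minr _ _) _; apply: margin_cross huv hvu q.
Qed.

(** [a + o] runs once through the residues modulo [tau], and at most [rho] of them are bad at each
    end. A random offset thus spoils a vertex with probability at most [2 * rho / tau]. *)
Lemma margin_offsets (a : nat) :
  \sum_(o < tau) (minn ((a + o) %% tau) (tau - (a + o) %% tau) < rho) <= 2 * rho.
Proof.
have -> : \sum_(o < tau) (minn ((a + o) %% tau) (tau - (a + o) %% tau) < rho) =
   \sum_(s < tau) (minn s (tau - s) < rho).
  pose sh (o : 'I_tau) := Ordinal (ltn_pmod (a + o) tau_gt0).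
  have shI : injective sh.
    move=> o o' /(congr1 val) /= /eqP; rewrite eqn_modDl !modn_small // => /eqP.
    exact: val_inj.
  by rewrite [RHS](reindex_inj shI).
apply: (@leq_trans (\sum_(s < tau) ((s < rho) + (tau - s < rho)))).
  by apply: leq_sum => s _; rewrite gtn_min; case: (_ < _); case: (_ < _).
have cnt : \sum_(s < tau) (s < rho) <= rho.
  rewrite -(big_mkord predT (fun s => nat_of_bool (s < rho))) (big_cat_nat _ (n := rho)) //=.
  have -> : \sum_(rho <= s < tau) (s < rho) = 0.
    by rewrite big_nat big1 // => s /andP[rs _]; rewrite ltnNge rs.
  rewrite addn0.
  by apply: leq_trans (leq_sum _ (fun s _ => leq_b1 _)) _; rewrite sum_nat_const_nat muln1 subn0.
rewrite big_split mul2n -addnn leq_add //= (reindex_inj rev_ord_inj) /=.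
apply: leq_trans cnt; apply: leq_sum => s _; rewrite subKn ?ltn_ord //.
by case: (ltnP s rho) => [_|rs]; rewrite ?leq_b1 // ltnNge (leq_trans rs).
Qed.

Definition chops (os : seq nat) : rel V := foldr chop light_edge os.

Lemma slicing_chops os : slicing (chops os).
Proof. by elim: os => [|o os IH]; [apply: slicing_light | apply: slicing_chop]. Qed.

Lemma chops_cutoff (U : {set V}) (j : nat) : U \subset [set v | light v] ->
  exists os f, [/\ size os = j, all (fun o => o < tau) os, cutoff (chops os) f &
     tau * #|[set v in U | f v < rho]| <= 2 * rho * j * #|U|].
Proof.
move=> Ul; elim: j => [|j [os [f [sz ot cf lost]]]].
  exists [::], light_cutoff; split=> //; first exact: cutoff_light.
  rewrite muln0 mul0n leqn0 muln_eq0 cards_eq0; apply/orP; right.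
  apply/eqP/setP => v; rewrite !inE; apply/andP => -[/(subsetP Ul)].
  by rewrite inE /light_cutoff => ->; rewrite ltnn.
have [o oP] : exists o : 'I_tau,
    tau * #|[set v in U | margin o (chops os) v < rho]| <= 2 * rho * #|U|.
  apply: (ex_leq_of_sum (Ordinal tau_gt0)).
  rewrite -big_distrr sum_nat_const card_ord leq_mul2l /=; apply/orP; right.
  under eq_bigr do rewrite -sum_nat_of_bool.
  rewrite exchange_big mulnC -sum_nat_const leq_sum // => v _.
  exact: margin_offsets.
exists ((o : nat) :: os), (fun v => minn (f v) (margin o (chops os) v)); split.
- by rewrite /= sz.
- by rewrite /= ltn_ord.
- by apply: cutoff_chop => //; apply: slicing_chops.
have : [set v in U | minn (f v) (margin o (chops os) v) < rho] \subset
   [set v in U | f v < rho] :|: [set v in U | margin o (chops os) v < rho].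
  by apply/subsetP => v; rewrite !inE gtn_min; case: (v \in U).
move=> /subset_leq_card/leq_trans/(_ (leq_card_setU _ _)) le.
apply: leq_trans (leq_mul (leqnn tau) le) _; rewrite mulnDr mulnS mulnDl addnC.
exact: leq_add.
Qed.

Context (h : nat).
Hypothesis h_gt1 : 1 < h.
Hypothesis no_minor : ~ clique_minor e h.

Lemma chop_model o r v m D : slicing r -> light v -> o < tau -> m < h ->
  rooted_model e w h tau (cls (chop o r) v) m (D + 24 * tau) ->
  rooted_model e w h tau (cls r v) m.+1 D.
Proof.
move=> sl lv ot mh.
have rootc : fingraph.root r v \in cls r v by rewrite inE connect_root.
have hE u : u \in cls r v -> lev e w (cls r v) (fingraph.root r v) u = height r u.
  by rewrite inE => vu; rewrite /height (cls_eq sl vu) (root_eq sl vu).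
have inc u : u \in cls (chop o r) v -> u \in cls r v.
  by rewrite !inE => /connect_chop[].
set k := (height r v + o) %/ tau.
(* Subtraction is truncated: for [k = 0] the lower end is 0 and the slab may be thinner than [tau],
   which is why [rooted_model_step] takes the upper end [a'] separately. *)
have slab y : (k * tau - o <= y < k * tau + tau - o) = ((y + o) %/ tau == k).
  apply/idP/eqP => [|<-]; last first.
    have := divn_eq (y + o) tau; have := ltn_pmod (y + o) tau_gt0.
    by move: ((y + o) %/ tau * tau) ((y + o) %% tau) ot; clear; lia.
  move=> /andP[y1 y2]; apply/eqP; rewrite eqn_leq -ltnS.
  by rewrite ltn_divLR // leq_divRL // mulSn; move: y1 y2 ot; clear; lia.
apply: (rooted_model_step e_sym w_gt0 tau_gt0 (a := k * tau - o) (a' := k * tau + tau - o)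
   (conn_cls v sl) rootc) => //.
- by move=> u; rewrite inE => vu; apply: connect_light vu lv.
- by move: ot; clear; lia.
- by apply/subsetP.
- move=> u uQ; rewrite hE ?inc // slab.
  by move: uQ; rewrite inE => /connect_chop[_ <-].
move=> u y; rewrite [u \in _]inE => vu yZ; rewrite hE // slab => yk euy.
have [vu' uk] := connect_chop vu.
rewrite inE; apply: connect_trans vu (connect1 _).
have [_ _ ind] := sl; rewrite /chop /= -uk eq_sym yk andbT.
apply: ind => //; first exact: connect_light vu' lv.
by move: yZ; rewrite inE; apply: connect_trans; rewrite slicing_sym.
Qed.

(** Undoing a chop adds one branch set and uses up [24 * tau] of separation. The head of [os] is the
    last chop applied, so it is undone first. *)
Lemma chops_model os v m D : light v -> all (fun o => o < tau) os -> m + size os <= h ->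
  rooted_model e w h tau (cls (chops os) v) m (D + 24 * tau * size os) ->
  exists Z, rooted_model e w h tau Z (m + size os) D.
Proof.
move=> lv; elim: os m => [|o os IH] m /=.
  by rewrite muln0 !addn0 => _ _ md; exists (cls light_edge v).
move=> /andP[ot oos] mh md; rewrite addnS -addSn.
apply: IH => //; first by move: mh; rewrite addnS addSn.
apply: (chop_model (slicing_chops os) lv ot); first by move: mh; clear; lia.
by move: md; rewrite mulnS addnA addnAC.
Qed.

(** Take a maximal set of points of the cluster pairwise more than [24 * tau * h] apart. More than
    [h] of them would supply the representatives of an empty model, and undoing the [h] chops would
    turn it into a clique minor. The balls around these points cover the cluster, and a ball with
    more than [r0] points of [U] would contain a set clumped at twice the radius. *)
Lemma cluster_card (U : {set V}) (r0 : nat) os v :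
  (forall S : {set V}, S \subset U -> #|S| = r0 -> ~~ clumped e w (48 * h * tau) S) ->
  all (fun o => o < tau) os -> size os = h -> light v ->
  #|U :&: cls (chops os) v| <= h * r0.
Proof.
move=> spread oos sz lv; set A := U :&: _; pose D := 24 * tau * h.
pose apart (S : {set V}) := (S \subset A) && [forall x in S, forall y in S, (x != y) ==> ~~ near setT D x y].
have ap0 : apart set0.
  by rewrite /apart sub0set; apply/forall_inP => x; rewrite inE.
have [S /andP[SA /forall_inP Sap] Smax] := @arg_maxnP _ set0 apart (fun S => #|S|) ap0.
have Sh : #|S| <= h.
  rewrite leqNgt; apply/negP => hS; apply: no_minor.
  have S0 : #|S| > 0 by apply: leq_ltn_trans hS.
  pose c (j : 'I_h) := enum_val (widen_ord (ltnW hS) j).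
  have cS j : c j \in S by apply: enum_valP.
  have [||Z] := @chops_model os v 0 0 lv oos; first by rewrite sz.
    exists c, (fun=> set0); split=> //.
    - by move=> j; have := subsetP SA _ (cS j); rewrite inE => /andP[].
    - move=> j l jl; rewrite sz add0n.
      have /forall_inP/(_ _ (cS l))/implyP := Sap _ (cS j); apply.
      by apply: contra jl => /eqP /enum_val_inj/(congr1 val) /= jl; apply/eqP/val_inj.
  rewrite sz add0n; exact: rooted_model_minor.
have lA u : u \in A -> light u.
  by rewrite !inE => /andP[_ vu]; apply: connect_light (slicing_chops os) vu lv.
have cover u : u \in A -> exists2 s, s \in S & near setT D s u.
  move=> uA; have [uS|uS] := boolP (u \in S).
    exists u => //; apply: near_mono (near_refl e w (in_setT u)) => //.
    apply: leq_trans (lA u uA) _; by rewrite /D mulnAC leq_pmull // muln_gt0 /= ltnW.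
  apply/exists_inP; rewrite -[X in is_true X]negbK; apply/negP => /exists_inPn far.
  have /Smax : apart (u |: S).
    rewrite /apart subUset sub1set uA SA; apply/forall_inP => x xS; apply/forall_inP => y yS.
    apply/implyP => xy; case/setU1P: xS xy => [->|xS]; case/setU1P: yS => [->|yS] xy.
    - by rewrite eqxx in xy.
    - by rewrite near_sym; apply: far.
    - exact: far.
    - by have /forall_inP/(_ _ yS)/implyP := Sap x xS; apply.
  by rewrite /= cardsU1 uS add1n ltnn.
apply: (@leq_trans (\sum_(s in S) #|[set u in A | near setT D s u]|)).
  rewrite -sum1_card; under [leqRHS]eq_bigr do rewrite -sum_nat_of_bool.
  rewrite [leqRHS]exchange_big leq_sum // => u /cover[s sS su].
  by rewrite (bigD1 s) //= su.
apply: (@leq_trans (\sum_(s in S) r0)); last by rewrite sum_nat_const leq_mul2r Sh orbT.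
apply: leq_sum => s sS; rewrite leqNgt; apply/negP => /ltnW/subset_of_card[B BA cB].
have BU : B \subset U.
  by apply: subset_trans BA _; apply/subsetP => u; rewrite !inE => /andP[/andP[]].
have /negP := spread B BU cB; apply.
apply/forall_inP => x xB; apply/forall_inP => y yB.
have -> : 48 * h * tau = D + D by rewrite /D; clear; lia.
have := subsetP BA x xB; have := subsetP BA y yB; rewrite !inE => /andP[_ sy] /andP[_ sx].
by apply: (near_trans e_sym _ sy); rewrite near_sym.
Qed.

End Chops.

(** * Bundles of clusters *)

(** Peel off minimal sets of mass at least [R]: dropping one item falls below [R], so each has mass
    at most [2 * R]. *)
Lemma bundling (T : finType) (m : T -> nat) (R N : nat) (A : {set T}) :
  (forall c, m c <= R) -> 2 * R * N <= \sum_(c in A) m c ->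
  exists b : T -> nat, forall i, i < N -> R <= \sum_(c in A | b c == i) m c.
Proof.
move=> mR; elim: N A => [|N IH] A big; first by exists (fun=> 0).
pose heavy (B : {set T}) := (B \subset A) && (R <= \sum_(c in B) m c).
have hA : heavy A.
  by rewrite /heavy subxx (leq_trans _ big) // mulnS (leq_trans _ (leq_addr _ _)) // leq_pmull.
have [B /minsetP[/andP[BA BR] Bmin] _] := minset_exists hA.
have B2 : \sum_(c in B) m c <= 2 * R.
  have [->|/set0Pn[c cB]] := eqVneq B set0; first by rewrite big_set0.
  rewrite (big_setD1 c) //= mul2n -addnn leq_add //.
  rewrite leqNgt; apply/negP => lt.
  have /Bmin/(_ (subsetDl _ _))/setP/(_ c) : heavy (B :\ c).
    by rewrite /heavy (subset_trans (subsetDl _ _) BA) ltnW.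
  by rewrite !inE eqxx cB.
have AB : \sum_(c in A) m c = \sum_(c in B) m c + \sum_(c in A :\: B) m c.
  by rewrite (big_setID B) /= (setIidPr BA).
have [|b bP] := IH (A :\: B).
  by move: big; rewrite AB mulnS; move: B2; clear; lia.
exists (fun c => if c \in B then N else b c) => i; rewrite ltnS leq_eqVlt.
have sub (P Q : pred T) : (forall c, P c -> Q c) -> \sum_(c | P c) m c <= \sum_(c | Q c) m c.
  move=> PQ; rewrite big_mkcond [leqRHS]big_mkcond leq_sum // => c _.
  by case: ifP => // /PQ ->.
case/predU1P => [->|iN].
  apply: leq_trans BR _; apply: sub => c cB.
  by rewrite cB (subsetP BA) ?eqxx.
apply: leq_trans (bP i iN) _; apply: sub => c.
by rewrite inE => /andP[/andP[/negbTE -> ->]].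
Qed.

Section Bundles.
Context (V : finType) (e : rel V) (e_sym : symmetric e) (h : nat).
Hypothesis h_gt1 : 1 < h.
Hypothesis no_minor : ~ clique_minor e h.
Context (q k : nat).
Local Notation K0 := (144 * (2 ^ h.+1 + 1)).
Local Notation r := (K0 * q.+1).
Local Notation n := #|V|.
Local Notation Xi := (16 * (K0 + 1) ^ 2).

(** The complement of the union of a maximum clump family: a clumped [r]-set inside it could be
    added to the family. *)
Lemma unclumped_part (w : V -> nat) (delta : nat) :
  (forall FS, clump_family e w r delta FS -> 2 * #|cover FS| < n) ->
  exists U : {set V}, n <= 2 * #|U| /\
    forall S : {set V}, S \subset U -> #|S| = r -> ~~ clumped e w delta S.
Proof.
move=> cov.
have r0 : 0 < r by rewrite muln_gt0 muln_gt0 addn_gt0 orbT.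
have c0 : clump_family e w r delta set0.
  rewrite /clump_family; apply/andP; split.
    by apply/trivIsetP => A B; rewrite inE.
  by apply/forall_inP => S; rewrite inE.
have [FS cF Fmax] := @arg_maxnP _ set0 (clump_family e w r delta) (fun FS => #|FS|) c0.
exists (~: cover FS); split.
  by have := cov FS cF; have := cardsC (cover FS); lia.
move=> S SU cS; apply/negP => cl.
have dS B : B \in FS -> [disjoint S & B].
  move=> BF; rewrite disjoint_sym disjoints_subset.
  by apply: subset_trans (bigcup_sup B BF) _; rewrite -setCS setCK.
have SF : S \notin FS.
  apply/negP => /dS; rewrite -setI_eq0 setIid -cards_eq0 cS => /eqP r00.
  by rewrite r00 in r0.
have /Fmax : clump_family e w r delta (S |: FS).
  have /andP[/trivIsetP tr /forall_inP FP] := cF; apply/andP; split.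
    apply/trivIsetP => A B /setU1P[->|AF] /setU1P[->|BF] AB.
    - by rewrite eqxx in AB.
    - exact: dS.
    - by rewrite disjoint_sym; apply: dS.
    - exact: tr.
  by apply/forall_inP => B /setU1P[->|/FP //]; rewrite cS eqxx.
by rewrite /= cardsU1 SF add1n ltnn.
Qed.

Lemma card_heavy_le (w : V -> nat) (tau : nat) :
  tau ^ 2 * #|[set v | tau < w v]| <= \sum_v w v ^ 2.
Proof.
rewrite mulnC -sum_nat_const big_mkcond leq_sum // => v _; rewrite inE.
by case: ifP => // /ltnW tw; rewrite leq_exp2r.
Qed.

Lemma bundled_cutoff : 0 < n ->
  8 * (16 * Xi * (48 * h) ^ 2) <= q.+1 -> 32 * h * r * k <= n ->
  exists (w f b : V -> nat) (rho : nat),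
  [/\ 0 < rho, r * \sum_v w v ^ 2 <= 16 * Xi * n * (48 * h * (8 * h * rho)) ^ 2,
      forall u v, e u v ->
        if b u == b v then f u <= f v + (w u + w v) else f u <= w u + w v &
      forall i, i < 2 * k -> h * r * rho ^ 2 <= \sum_(v | b v == i) f v ^ 2].
Proof.
move=> n0 qbig nbig.
have K00 : 0 < K0 by rewrite muln_gt0 addn_gt0 orbT.
have r0 : 0 < r by rewrite muln_gt0 K00.
have h0 : 0 < h by apply: ltnW.
(* The scale is free, as the final quotient is homogeneous in [rho]; this one makes
   [delta = 48 * h * tau] a multiple of [r ^ 2] and at least [n ^ 2 * r]. The ratio [8 * h] lets [h]
   chops spoil at most a quarter of [U], and [48 * h * tau] is the diameter in [cluster_card]. *)
pose rho := n ^ 2 * r ^ 2; pose tau := 8 * h * rho.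
have rho0 : 0 < rho by rewrite /rho muln_gt0 !expn_gt0 n0 r0.
have tau0 : 0 < tau by rewrite /tau muln_gt0 muln_gt0 h0.
have rt : rho <= tau by rewrite leq_pmull // muln_gt0.
have [||||w [w0 wn wF]] := @spread_exists V e e_sym h no_minor q (48 * h * tau) _ (48 * h * (8 * h * n ^ 2)).
- apply: (@leq_trans rho).
    by rewrite /rho leq_mul2l -mulnn leq_pmulr // orbT.
  by apply: leq_trans rt _; rewrite leq_pmull // muln_gt0.
- exact: n0.
- by rewrite muln_gt0 muln_gt0 h0 muln_gt0 muln_gt0 h0 expn_gt0 n0.
- by rewrite /tau /rho; move: (r ^ 2) (n ^ 2) => x y; clear; lia.
have [U1 [nU1 U1P]] := unclumped_part wF.
pose Hv := [set v | tau < w v].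
(* Chebyshev: the bound on the sum of w^2 allows at most [16 * Xi * (48 * h) ^ 2 * n / q.+1] heavy
   vertices, and [qbig] supplies the factor 8. *)
have cHv : 8 * #|Hv| <= n.
  have M0 : 0 < 16 * Xi * (48 * h) ^ 2.
    have X0 : 0 < Xi by rewrite muln_gt0 expn_gt0 addn_gt0 orbT.
    by rewrite muln_gt0 [0 < 16 * Xi]muln_gt0 X0 expn_gt0 muln_gt0 h0.
  have t20 : 0 < tau ^ 2 by rewrite expn_gt0 tau0.
  have H1 : r * (tau ^ 2 * #|Hv|) <= 16 * Xi * n * (48 * h * tau) ^ 2.
    by apply: leq_trans wn; rewrite leq_mul2l card_heavy_le orbT.
  have H2 : q.+1 * #|Hv| <= 16 * Xi * (48 * h) ^ 2 * n.
    rewrite -(leq_pmul2l t20); apply: leq_trans (_ : r * (tau ^ 2 * #|Hv|) <= _).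
      by rewrite mulnCA leq_mul2r leq_pmull ?orbT.
    by apply: leq_trans H1 _; rewrite expnMn; move: (Xi) ((48 * h) ^ 2) (tau ^ 2) (n); clear; lia.
  rewrite -(leq_pmul2l M0); apply: leq_trans H2.
  by rewrite mulnA [X in X * _]mulnC leq_mul2r qbig orbT.
pose U := U1 :\: Hv.
have Ul : U \subset [set v | w v <= tau].
  by apply/subsetP => v; rewrite !inE -leqNgt => /andP[].
have cU : #|U1| <= #|U| + #|Hv|.
  by rewrite -(cardsID Hv U1) addnC leq_add2l subset_leq_card // subsetIr.
have [os [f [sz ot [f1 f2 f3] lost]]] := chops_cutoff e_sym tau0 rt h Ul.
pose good := [set v in U | rho <= f v].
(* Of at least [n / 2] vertices in [U1], at most [n / 8] are heavy and a quarter of the others are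
   spoiled. *)
have cgood : n <= 8 * #|good|.
  have lost4 : 4 * #|[set v in U | f v < rho]| <= #|U|.
    have c0 : 0 < 2 * rho * h by rewrite muln_gt0 h0 andbT muln_gt0 rho0.
    rewrite -(leq_pmul2l c0); apply: leq_trans lost.
    by rewrite /tau; move: (rho) (#|[set v in U | f v < rho]|) (h); clear; lia.
  have UE : #|U| = #|good| + #|[set v in U | f v < rho]|.
    rewrite -(cardsID good U); congr (_ + _); apply: eq_card => v.
      by rewrite !inE; case: (v \in U1); case: (tau < w v); rewrite ?andbF.
    by rewrite !inE; case: (v \in U1); case: (tau < w v) => //=; rewrite ltnNge andbT.
  by move: lost4 UE cU cHv nU1; clear; lia.
pose rt_ := fingraph.root (chops e w tau os).
pose m c := #|[set v in good | rt_ v == c]|.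
have sl := slicing_chops e_sym w tau os.
have mR c : m c <= h * r.
  rewrite /m; have [->|/set0Pn[v]] := eqVneq [set v in good | rt_ v == c] set0; first by rewrite cards0.
  rewrite !inE => /andP[/andP[/andP[vH _] _] /eqP vc].
  apply: (@leq_trans #|U :&: cls (chops e w tau os) v|).
    apply: subset_leq_card; apply/subsetP => u; rewrite !inE => /andP[/andP[uU _] /eqP uc].
    by rewrite uU -(root_connect (slicing_sym sl)) -/(rt_ v) -/(rt_ u) vc uc eqxx.
  apply: (cluster_card e_sym w0 tau0 h_gt1 no_minor) => //; last by rewrite leqNgt.
  by move=> S SU; apply: U1P; apply: subset_trans SU (subsetDl _ _).
(* This needs [4 * h * r * k] good vertices; with [n / 8] of them available, that is the 32 in
   [nbig]. *)
have [|b bP] := @bundling V m (h * r) (2 * k) setT mR.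
  have -> : \sum_(c in setT) m c = #|good|.
    rewrite -sum1_card [RHS](partition_big rt_ (mem setT)) //=.
    by apply: eq_bigr => c _; rewrite /m -sum1dep_card.
  by move: nbig cgood; move: (r) (n) (#|good|) (h) (k); clear; lia.
exists w, f, (fun v => b (rt_ v)), rho; split=> //.
- move=> u v uv; have := f3 u v uv; case: ifP => [ruv fuv|_ fuv].
    have -> : rt_ u = rt_ v by apply: (root_eq sl); apply: connect1.
    by rewrite eqxx.
  by case: ifP => // _; apply: leq_trans fuv (leq_addl _ _).
move=> i ik; apply: (@leq_trans (\sum_(v in good | b (rt_ v) == i) rho ^ 2)).
  rewrite sum_nat_cond_const leq_mul2r; apply/orP; right.
  apply: leq_trans (bP i ik) _; rewrite -sum1dep_card [leqRHS](partition_big rt_ (fun c => (c \in setT) && (b c == i))) /=.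
    apply: leq_sum => c /andP[_ /eqP bc]; rewrite /m -sum1dep_card.
    rewrite big_mkcond [leqRHS]big_mkcond; apply: leq_sum => v _.
    by case: (v \in good) => //=; case: eqP => //= ->; rewrite bc eqxx.
  by move=> v /andP[_ ->]; rewrite inE.
rewrite big_mkcond [leqRHS]big_mkcond; apply: leq_sum => v _.
case: (boolP (v \in good)) => //=; rewrite inE => /andP[_ rf].
by case: ifP => // _; rewrite leq_exp2r.
Qed.

End Bundles.

(** * Test functions *)

(** One of the two truncated differences is 0, so their sum is the absolute difference. *)
Definition sqdist (a b : nat) : nat := (a - b + (b - a)) ^ 2.

Section Bumps.
Context (V : finType) (e : rel V) (e_sym : symmetric e) (d : nat).
Hypothesis deg_le : forall v, \sum_u e v u <= d.

Lemma energy_le (w : V -> nat) :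
  \sum_u \sum_v e u v * (w u + w v) ^ 2 <= 4 * d * \sum_v w v ^ 2.
Proof.
have side : \sum_u \sum_v e u v * w u ^ 2 <= d * \sum_v w v ^ 2.
  rewrite big_distrr leq_sum // => u _.
  by rewrite -big_distrl leq_mul2r /= deg_le orbT.
apply: (@leq_trans (\sum_u \sum_v (2 * (e u v * w u ^ 2) + 2 * (e v u * w v ^ 2)))).
  apply: leq_sum => u _; apply: leq_sum => v _; rewrite [e v u]e_sym.
  by case: (e u v) => //=; have [+ _] := nat_Cauchy (w u) (w v); rewrite sqrnD !mul1n;
    move: (w u ^ 2) (w v ^ 2) (w u * w v); lia.
under eq_bigr do rewrite big_split /=; rewrite big_split /= [X in _ + X]exchange_big /=.
under eq_bigr do rewrite -big_distrr /=; rewrite -big_distrr /=.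
move: side; move: (\sum_u \sum_v _) (\sum_v w v ^ 2) => x y; lia.
Qed.

Context (w f b : V -> nat).
Hypothesis f_edge : forall u v, e u v ->
  if b u == b v then f u <= f v + (w u + w v) else f u <= w u + w v.

Definition bump (i : nat) (v : V) : nat := if b v == i then f v else 0.

Lemma bump_edge i u v : e u v ->
  sqdist (bump i u) (bump i v) <= ((b u == i) + (b v == i)) * (w u + w v) ^ 2.
Proof.
move=> uv; have fu := f_edge uv; have fv : if b u == b v then f v <= f u + (w u + w v) else f v <= w u + w v.
  by rewrite eq_sym [w u + _]addnC; apply: f_edge; rewrite e_sym.
rewrite /sqdist /bump; case: (eqVneq (b u) i) => bu; case: (eqVneq (b v) i) => bv //=.
- rewrite bu bv eqxx in fu fv; apply: leq_trans (leq_pmull _ _) => //.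
  by rewrite leq_exp2r //; move: fu fv; clear; lia.
- by rewrite bu eq_sym (negbTE bv) in fu; rewrite sub0n subn0 addn0 mul1n leq_exp2r.
- by rewrite bv (negbTE bu) in fv; rewrite sub0n subn0 mul1n leq_exp2r.
Qed.

(** An edge is charged only to the bumps of its two ends, which doubles the bound of [energy_le],
    whatever [N] is. *)
Lemma sum_bump_energy (N : nat) :
  \sum_(i < N) \sum_u \sum_v e u v * sqdist (bump i u) (bump i v) <= 8 * d * \sum_v w v ^ 2.
Proof.
have one (c : nat) : \sum_(i < N) (c == i) <= 1.
  have [cN|cN] := ltnP c N.
    rewrite (bigD1 (Ordinal cN)) //= big1 ?addn0 ?leq_b1 // => i ic.
    by apply/eqP; rewrite eqb0; apply: contra ic => /eqP ci; apply/eqP/val_inj; rewrite /= ci.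
  by rewrite big1 // => i _; rewrite gtn_eqF // (leq_trans (ltn_ord i)).
apply: (@leq_trans (2 * \sum_u \sum_v e u v * (w u + w v) ^ 2)); last first.
  by have := energy_le w; move: (\sum_u _) (\sum_v w v ^ 2) => x y; lia.
rewrite exchange_big big_distrr leq_sum //= => u _.
rewrite exchange_big big_distrr leq_sum //= => v _.
have [uv|_] /= := boolP (e u v); last by rewrite big1.
rewrite mul1n; apply: (@leq_trans (\sum_(i < N) ((b u == i) + (b v == i)) * (w u + w v) ^ 2)).
  by apply: leq_sum => i _; rewrite mul1n bump_edge.
by rewrite -big_distrl leq_mul2r big_split /= (leq_add (one _) (one _)) orbT.
Qed.

(** Markov: fewer than [k] cheap bumps among [2 * k] would leave more than [k] expensive ones,
    exceeding the total energy. *)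
Lemma cheap_bumps (k : nat) : exists c : 'I_k -> nat,
  [/\ injective c, forall i, c i < 2 * k &
      forall i, k * \sum_u \sum_v e u v * sqdist (bump (c i) u) (bump (c i) v)
                <= 8 * d * \sum_v w v ^ 2].
Proof.
set B := 8 * d * _.
pose E (i : nat) := \sum_u \sum_v e u v * sqdist (bump i u) (bump i v).
pose good := [set i : 'I_(2 * k) | k * E i <= B].
have cg : k <= #|good|.
  rewrite leqNgt; apply/negP => gk.
  have cb : k < #|~: good| by have := cardsC good; rewrite card_ord; move: gk; clear; lia.
  have total : k * \sum_(i < 2 * k) E i <= k * B by rewrite leq_mul2l sum_bump_energy orbT.
  have big : #|~: good| * B.+1 <= k * \sum_(i < 2 * k) E i.
    rewrite -sum_nat_const big_distrr big_mkcond leq_sum //= => i _.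
    by rewrite !inE -ltnNge; case: ifP.
  have := leq_trans (leq_trans (leq_mul cb (leqnn B.+1)) big) total.
  by clear; nia.
exists (fun i => enum_val (widen_ord cg i) : 'I_(2 * k)); split=> [i j /val_inj/enum_val_inj/(congr1 val) /= ij|i|i].
- exact: val_inj.
- exact: ltn_ord.
- by have := enum_valP (widen_ord cg i); rewrite inE.
Qed.

End Bumps.

Section DisjointBumps.
Context (V : finType) (e : rel V) (e_sym : symmetric e) (h d : nat).
Hypothesis h_gt1 : 1 < h.
Hypothesis no_minor : ~ clique_minor e h.
Hypothesis deg_le : forall v, \sum_u e v u <= d.
Local Notation K0 := (144 * (2 ^ h.+1 + 1)).
Local Notation n := #|V|.
Local Notation Xi := (16 * (K0 + 1) ^ 2).
Local Notation q0 := (8 * (16 * Xi * (48 * h) ^ 2)).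
Local Notation C0 := (8 * (16 * Xi * (48 * h * (8 * h)) ^ 2) * (64 * h) ^ 2).

(** Up to factors depending on [h]: a cheap bump has energy at most [d * n * rho ^ 2 / (r * k)] and
    mass at least [r * rho ^ 2], so its quotient is [d * n / (r ^ 2 * k)], which is [d * k / n] for
    [r] of order [n / k]. *)
Lemma disjoint_bumps (k : nat) : 0 < k -> 32 * h * K0 * k * q0 <= n ->
  exists g : 'I_k -> V -> nat,
  [/\ forall v i j, g i v != 0 -> g j v != 0 -> i = j,
      forall i, exists v, g i v != 0 &
      forall i, n * (\sum_u \sum_v e u v * sqdist (g i u) (g i v))
                <= C0 * d * k * \sum_v g i v ^ 2].
Proof.
move=> k0 nbig.
have h0 : 0 < h by apply: ltnW.
have K00 : 0 < K0 by rewrite muln_gt0 addn_gt0 orbT.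
have X0 : 0 < Xi by rewrite muln_gt0 expn_gt0 addn_gt0 orbT.
have q00 : 0 < q0.
  by rewrite muln_gt0 /= muln_gt0 [0 < 16 * Xi]muln_gt0 X0 expn_gt0 muln_gt0 h0.
have m00 : 0 < 32 * h * K0 * k by rewrite muln_gt0 k0 andbT muln_gt0 K00 andbT muln_gt0 h0.
have n0 : 0 < n by apply: leq_trans nbig; rewrite muln_gt0 m00.
set m0 := 32 * h * K0 * k in m00 nbig.
have qn : q0 <= n %/ m0 by rewrite leq_divRL // mulnC.
(* This puts [r] within a factor 2 of [n / (32 * h * k)]: [rn] is the upper bound required by
   [bundled_cutoff], [nr] the lower bound used in the quotient. *)
pose q := (n %/ m0).-1.
have qE : q.+1 = n %/ m0 by rewrite /q prednK // (leq_trans q00).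
have rn : 32 * h * (K0 * q.+1) * k <= n.
  apply: leq_trans (leq_trunc_div n m0); rewrite -qE /m0.
  by move: (K0) (q.+1) => x y; clear; lia.
have nr : n <= 64 * h * k * (K0 * q.+1).
  have := ltn_ceil n m00; rewrite -qE /m0.
  by move: (K0) => x; clear; nia.
have [w [f [b [rho [rho0 wE fE mass]]]]] := bundled_cutoff e_sym h_gt1 no_minor n0
  (leq_trans qn (eq_leq (esym qE))) rn.
set r := K0 * q.+1 in wE mass nr rn.
have r0 : 0 < r by rewrite muln_gt0 K00.
have [c [cinj ck cE]] := cheap_bumps e_sym deg_le fE k.
have massE i : \sum_v bump f b (c i) v ^ 2 = \sum_(v | b v == c i) f v ^ 2.
  by rewrite [RHS]big_mkcond; apply: eq_bigr => v _; rewrite /bump; case: ifP.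
exists (fun i => bump f b (c i)); split=> [v i j|i|i].
- rewrite /bump; case: (eqVneq (b v) (c i)) => // vi _; case: (eqVneq (b v) (c j)) => // vj _.
  by apply: cinj; rewrite -vi -vj.
- have pos : 0 < \sum_v bump f b (c i) v ^ 2.
    rewrite massE; apply: leq_trans (mass (c i) (ck i)).
    by rewrite muln_gt0 expn_gt0 rho0 andbT muln_gt0 h0.
  have [/existsP //|/existsPn z] := boolP [exists v, bump f b (c i) v != 0].
  by move: pos; rewrite big1 // => v _; have := z v; rewrite negbK => /eqP ->.
rewrite massE; apply: leq_trans (leq_mul (leqnn _) (mass (c i) (ck i))).
have := cE i; move: (\sum_u _) => En kE.
have kr : 0 < k * r by rewrite muln_gt0 k0.
rewrite -(leq_pmul2l kr).
have s1 : k * r * (n * En) <= n * (8 * d * (r * \sum_v w v ^ 2)).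
  by move: kE; move: (\sum_v w v ^ 2) => S kE; have := leq_mul (leqnn (r * n)) kE; clear; lia.
apply: leq_trans s1 _.
have s2 := leq_mul (leqnn (n * (8 * d))) wE.
rewrite mulnA; apply: leq_trans s2 _.
have s3 := leq_mul nr nr.
have -> : n * (8 * d) * (16 * Xi * n * (48 * h * (8 * h * rho)) ^ 2) =
   8 * d * (16 * Xi * (48 * h * (8 * h)) ^ 2) * rho ^ 2 * (n * n).
  have -> : 48 * h * (8 * h * rho) = 48 * h * (8 * h) * rho by rewrite !mulnA.
  rewrite expnMn; move: (Xi) ((48 * h * (8 * h)) ^ 2) (rho ^ 2) (n) => x1 x2 x3 x4.
  by clear; lia.
apply: leq_trans (leq_mul (leqnn _) s3) _.
have -> : 64 * h * k * r * (64 * h * k * r) = (64 * h) ^ 2 * k * k * r * r.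
  by rewrite -mulnn; clear; lia.
move: (16 * Xi * (48 * h * (8 * h)) ^ 2) ((64 * h) ^ 2) (rho ^ 2) => x1 x2 x3.
have -> : k * r * (8 * x1 * x2 * d * k * (h * r * x3)) = 8 * d * x1 * x3 * (x2 * k * k * r * r) * h.
  by clear; lia.
by rewrite leq_pmulr.
Qed.

End DisjointBumps.

(** * Laplacian eigenvalues *)

Local Open Scope ring_scope.
Local Open Scope sesquilinear_scope.

Lemma char_poly_similar_diag (K : fieldType) (n : nat) (P : 'M[K]_n) (D : 'rV[K]_n) :
  P \in unitmx ->
  char_poly (invmx P *m diag_mx D *m P) = \prod_(i < n) ('X - (D 0 i)%:P).
Proof.
move=> Pu.
have -> : char_poly (invmx P *m diag_mx D *m P) = char_poly (diag_mx D).
  rewrite /char_poly /char_poly_mx.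
  have Q1 : map_mx polyC (invmx P) *m map_mx polyC P = 1%:M.
    by rewrite -map_mxM mulVmx // map_mx1.
  have -> : 'X%:M - map_mx polyC (invmx P *m diag_mx D *m P) =
     map_mx polyC (invmx P) *m ('X%:M - map_mx polyC (diag_mx D)) *m map_mx polyC P.
    rewrite mulmxBr mulmxBl !map_mxM; congr (_ - _).
    by rewrite mul_mx_scalar -scalemxAl Q1 scalemx1.
  rewrite !det_mulmx mulrC mulrA -det_mulmx.
  have -> : map_mx polyC P *m map_mx polyC (invmx P) = 1%:M.
    by rewrite -map_mxM mulmxV // map_mx1.
  by rewrite det1 mul1r.
rewrite char_poly_trig ?diag_mx_is_trig //.
by apply: eq_bigr => i _; rewrite mxE eqxx mulr1n.
Qed.

Lemma nth_sorted_count_le (R : realType) (s : seq R) (k : nat) (B : R) :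
  sorted <=%R s -> (k < count (fun x : R => (x <= B)%R) s)%N -> nth 0 s k <= B.
Proof.
move=> ss; apply: contraTT; rewrite -ltNge -leqNgt => Bk.
have [ks|ks] := ltnP k (size s); last exact: (leq_trans (count_size _ _)).
rewrite -(cat_take_drop k s) count_cat.
have -> : count (fun x : R => (x <= B)%R) (drop k s) = 0%N.
  apply/eqP; rewrite -leqn0 leqNgt -has_count; apply/hasPn => x /(nthP 0)[j].
  rewrite size_drop ltn_subRL => js <-; rewrite nth_drop -ltNge.
  apply: (lt_le_trans Bk); apply: (sorted_leq_nth le_trans le_refl) => //.
  exact: leq_addr.
by rewrite addn0 (leq_trans (count_size _ _)) // size_take ks.
Qed.

Lemma sorted_flatten_nseq (R : realType) (m : R -> nat) (s : seq R) :
  sorted <=%R s -> sorted <=%R (flatten [seq nseq (m x) x | x <- s]).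
Proof.
rewrite !(sorted_pairwise le_trans); elim: s => //= x s IH /andP[xs ss].
rewrite pairwise_cat IH // andbT; apply/andP; split.
  apply/allrelP => y z; rewrite mem_nseq => /andP[_ /eqP ->].
  by move=> /flattenP[_ /mapP[w ws ->]]; rewrite mem_nseq => /andP[_ /eqP ->]; apply: (allP xs).
elim: (m x) => //= j ->; rewrite andbT.
by apply/allP => y; rewrite mem_nseq => /andP[_ /eqP ->].
Qed.

(** Distinct roots repeated by multiplicity form a permutation of the list of linear factors. *)
Lemma count_flatten_mup (R : realType) (ds : seq R) (B : R) :
  let p := \prod_(d <- ds) ('X - d%:P) in
  count (fun x : R => (x <= B)%R) (flatten [seq nseq (mup x p) x | x <- rootsR p])
  = count (fun x : R => (x <= B)%R) ds.
Proof.
move=> p.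
have p0 : p != 0 by rewrite monic_neq0 ?monic_prod_XsubC.
have mE x : mup x p = count_mem x ds by apply: mu_prod_XsubC.
suff : perm_eq (flatten [seq nseq (mup x p) x | x <- rootsR p]) ds.
  by move=> /permP ->.
have rE x : (x \in rootsR p) = (x \in ds).
  rewrite -(roots_on_rootsR p0) in_itv /= root_prod_XsubC //.
have ur : uniq (rootsR p).
  by have := sorted_roots (- cauchy_bound p) (cauchy_bound p) p; apply: sorted_uniq; [exact: lt_trans | exact: ltxx].
apply/allP => x _ /=; apply/eqP.
rewrite count_flatten -map_comp.
rewrite (eq_map (g := fun y => (y == x) * count_mem x ds)%N); last first.
  move=> y /=; rewrite count_nseq /= mE; case: eqP => [->|] //.
rewrite sumnE big_map.
have [xr|xr] := boolP (x \in rootsR p).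
  rewrite (bigD1_seq x) //= eqxx mul1n big1 ?addn0 // => y /negbTE -> //.
rewrite big_seq big1 => [|y yr]; last first.
  by case: eqP => // yx; rewrite -yx yr in xr.
by apply/esym/count_memPn; rewrite -rE.
Qed.

(** The spectral theorem is used over [R[i]], where [A] is hermitian with real eigenvalues;
    injectivity of the coefficient embedding brings the factorisation back to [R]. *)
Lemma symmetric_spectral (R : realType) (n : nat) (A : 'M[R]_n) : A^T = A ->
  exists (P : 'M[R[i]]_n) (d : 'I_n -> R),
    [/\ P \is unitarymx,
        map_mx (real_complex R) A = P^t* *m diag_mx (\row_i (d i)%:C%C) *m P &
        char_poly A = \prod_(i < n) ('X - (d i)%:P)].
Proof.
move=> At; pose Ac := map_mx (real_complex R) A.
have Ah : Ac \is hermsymmx.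
  apply: realsym_hermsym.
    by apply/is_hermitianmxP; rewrite expr0 scale1r map_mx_id // /Ac map_trmx At.
  by apply/mxOverP => i j; rewrite mxE; apply/complex_realP; exists (A i j).
have /hermitian_normalmx/orthomx_spectralP AE := Ah.
have /mxOverP dr := hermitian_spectral_diag_real Ah.
set P := spectralmx Ac in AE; set D := spectral_diag Ac in AE dr.
have Pu : P \is unitarymx by apply: spectral_unitarymx.
exists P, (fun i => complex.Re (D 0 i)).
have DE : D = \row_i (complex.Re (D 0 i))%:C%C.
  by apply/rowP => i; rewrite mxE RRe_real.
split=> //.
  by rewrite -DE -invmx_unitary.
apply: (map_poly_inj (real_complex R)); rewrite map_char_poly -/Ac AE.
rewrite char_poly_similar_diag ?unitarymx_unit //.
rewrite rmorph_prod; apply: eq_bigr => i _.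
by rewrite /= rmorphB /= map_polyX map_polyC /= RRe_real.
Qed.

Lemma sum_normC_sq (R : realType) (n : nat) (y : 'rV[R[i]]_n) :
  (y *m y^t*) 0 0 = \sum_i `|y 0 i| ^+ 2.
Proof. by rewrite mxE; apply: eq_bigr => i _; rewrite !mxE -normCK. Qed.

(* The half of Courant-Fischer that is needed: a k-dimensional space meets the
   span of the eigenvectors of fewer than k missing eigenvalues. *)
Lemma count_eigenvalue_le (R : realType) (n k : nat) (A : 'M[R]_n) (P : 'M[R[i]]_n)
    (d : 'I_n -> R) (F : 'M[R[i]]_(k, n)) (B : R) :
  P \is unitarymx ->
  map_mx (real_complex R) A = P^t* *m diag_mx (\row_i (d i)%:C%C) *m P ->
  row_free F ->
  (forall c : 'rV[R[i]]_k, let x := c *m F in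
    (x *m map_mx (real_complex R) A *m x^t*) 0 0 <= B%:C%C * (x *m x^t*) 0 0) ->
  (k <= #|[set i | (d i <= B)%R]|)%N.
Proof.
move=> Pu AE Ff HB; rewrite leqNgt; apply/negP => Jk.
set J := [set i | d i <= B] in Jk.
(* Coordinates of the rows of [F] along the eigenvectors with eigenvalue at most [B]. There are
   fewer than [k] such columns, so a nonzero combination [c] has none of these coordinates and
   violates [HB]. *)
pose M := colsub (fun j : 'I_#|J| => enum_val j) (F *m P^t*).
have rM : (\rank M < k)%N by apply: leq_ltn_trans (rank_leq_col _) Jk.
have [c c0 cM] : exists2 c : 'rV_k, c != 0 & c *m M = 0.
  have : kermx M != 0 by rewrite -mxrank_eq0 mxrank_ker -lt0n subn_gt0.
  by case/rowV0Pn => c /sub_kermxP cM c0; exists c.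
pose x := c *m F; pose y := x *m P^t*.
have x0 : x != 0.
  by apply: contra c0 => /eqP x0; rewrite -(mulmx_free_eq0 c Ff) -/x x0.
have PP : P^t* *m P = 1%:M by rewrite -invmx_unitary // mulVmx // unitarymx_unit.
have xy : x = y *m P by rewrite /y -mulmxA PP mulmx1.
have y0 : y != 0 by apply: contra x0 => /eqP y0; rewrite xy y0 mul0mx.
have yJ j : j \in J -> y 0 j = 0.
  move=> jJ; have := congr1 (fun N : 'rV_ _ => N 0 (enum_rank_in jJ j)) cM.
  rewrite mxE [RHS]mxE => <-; rewrite /y /x -mulmxA mxE.
  by apply: eq_bigr => l _; rewrite [in RHS]mxE enum_rankK_in.
have := HB c; rewrite /= -/x.
have -> : (x *m x^t*) 0 0 = \sum_i `|y 0 i| ^+ 2.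
  rewrite -sum_normC_sq {1 2}xy trmx_mul map_mxM mulmxA mulmxtVK //.
have -> : (x *m map_mx (real_complex R) A *m x^t*) 0 0 =
    \sum_i (d i)%:C%C * `|y 0 i| ^+ 2.
  rewrite AE !mulmxA -/y.
  have -> : y *m diag_mx (\row_i (d i)%:C%C) *m P *m x^t* =
     y *m diag_mx (\row_i (d i)%:C%C) *m y^t*.
    have -> : y^t* = P *m x^t*.
      by rewrite /y trmx_mul map_mxM; congr (_ *m _); exact: trmxCK.
    by rewrite !mulmxA.
  rewrite mxE; apply: eq_bigr => i _.
  by rewrite mul_mx_diag !mxE normCK mulrAC mulrC.
rewrite mulr_sumr => /le_gtF /negbT /negP; apply.
have [i yi] : exists i, y 0 i != 0 by apply/rV0Pn.
rewrite [ltLHS](bigD1 i) //= [ltRHS](bigD1 i) //=.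
have key l : y 0 l != 0 -> B < d l.
  move=> yl; rewrite ltNge; apply/negP => dl.
  by move/eqP: yl; apply; apply: yJ; rewrite inE.
apply: ltr_leD.
  by rewrite ltr_pM2r ?exprn_gt0 ?normr_gt0 // ltcR key.
apply: ler_sum => l _; have [->|/key yl] := eqVneq (y 0 l) 0.
  by rewrite normr0 expr0n !mulr0.
by rewrite ler_wpM2r ?exprn_ge0 ?normr_ge0 // lecR ltW.
Qed.

(** * The quadratic form of the Laplacian and disjoint test functions *)

Lemma tr_laplacian (R : realType) (G : graph) :
  (laplacian R G)^T = laplacian R G.
Proof.
apply/matrixP => i j; rewrite !mxE (gsym j i) eq_sym.
by case: eqP => [->|].
Qed.

Lemma laplacian_quadratic (R : realType) (G : graph) (x : 'rV[R[i]]_(gn G)) :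
  (x *m map_mx (real_complex R) (laplacian R G) *m x^t*) 0 0 *+ 2 =
  \sum_u \sum_v (gadj G u v)%:R * `|x 0 u - x 0 v| ^+ 2.
Proof.
have S1 : (x *m map_mx (real_complex R) (laplacian R G) *m x^t*) 0 0 =
   \sum_u \sum_v (gadj G u v)%:R * (x 0 u * (x 0 u)^* - x 0 u * (x 0 v)^*).
  transitivity (\sum_v \sum_u x 0 u * ((deg u)%:R *+ (u == v) - (gadj G u v)%:R) * (x 0 v)^*).
    rewrite mxE; apply: eq_bigr => v _; rewrite [X in X * _]mxE mulr_suml.
    apply: eq_bigr => u _; rewrite !mxE; congr (_ * _ * _).
    by rewrite rmorphB rmorphMn /= !rmorph_nat.
  rewrite exchange_big; apply: eq_bigr => u _ /=.
  transitivity ((deg u)%:R * (x 0 u * (x 0 u)^*) -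
     \sum_v (gadj G u v)%:R * (x 0 u * (x 0 v)^*)).
    rewrite (bigD1 u) //= eqxx mulr1n [X in _ = _ - X](bigD1 u) //= girr mul0r add0r.
    rewrite subr0 mulrAC mulrC; congr (_ + _).
    rewrite -sumrN; apply: eq_bigr => v /negbTE vu.
    by rewrite [u == v]eq_sym vu mulr0n sub0r mulrN mulNr [in RHS]mulrA [_ * x 0 u]mulrC.
  have -> : (deg u)%:R = \sum_v (gadj G u v)%:R :> R[i].
    rewrite -natr_sum /deg -sum1dep_card big_mkcond /=.
    congr (1 *+ _).

  rewrite mulr_suml -sumrB; apply: eq_bigr => v _.
  by rewrite mulrBr.
rewrite mulr2n {2}S1 exchange_big S1 -big_split /=; apply: eq_bigr => u _.
rewrite -big_split /=; apply: eq_bigr => v _.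
rewrite [gadj G v u]gsym -mulrDr normCK rmorphB /=; congr (_ * _).
by rewrite mulrBl [x 0 u * (_ - _)]mulrBr [x 0 v * (_ - _)]mulrBr opprB.
Qed.

Lemma lambda_le_count (R : realType) (G : graph) (k : nat) (F : 'M[R[i]]_(k, gn G)) (B : R) :
  (0 < k)%N -> row_free F ->
  (forall c : 'rV[R[i]]_k, let x := c *m F in
    (x *m map_mx (real_complex R) (laplacian R G) *m x^t*) 0 0 <= B%:C%C * (x *m x^t*) 0 0) ->
  lambda R G k <= B.
Proof.
move=> k0 Ff HB; have [P [d [Pu AE pE]]] := symmetric_spectral (tr_laplacian R G).
have kd := count_eigenvalue_le Pu AE Ff HB.
rewrite /lambda /lap_eigs; apply: nth_sorted_count_le.
  by apply: sorted_flatten_nseq; apply: (sub_sorted ltW); apply: sorted_roots.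
have -> : char_poly (laplacian R G) = \prod_(z <- [seq d i | i <- enum 'I_(gn G)]) ('X - z%:P).
  by rewrite pE big_map big_enum.
rewrite count_flatten_mup count_map prednK //; apply: (leq_trans kd).
by rewrite -sum1dep_card -sum1_count big_enum_cond /=.
Qed.

Lemma normC_sub_sqr (C : numClosedFieldType) (p q : C) :
  `|p - q| ^+ 2 <= 2 * (`|p| ^+ 2 + `|q| ^+ 2).
Proof.
rewrite -subr_ge0; have -> : 2 * (`|p| ^+ 2 + `|q| ^+ 2) - `|p - q| ^+ 2 = `|p + q| ^+ 2.
  by rewrite !normCK rmorphB rmorphD /=; ring.
by rewrite exprn_ge0.
Qed.

(** Only an edge joining two different supports needs care: there [normC_sub_sqr] loses a factor 2.
    It is regained because the hypothesis sums over ordered pairs and so bounds twice the energy of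
    each function. *)
Lemma lambda_le_disjoint (R : realType) (G : graph) (k : nat)
    (F : 'I_k -> 'I_(gn G) -> R) (B : R) :
  (0 < k)%N ->
  (forall u i j, F i u != 0 -> F j u != 0 -> i = j) ->
  (forall i, exists u, F i u != 0) ->
  (forall i, \sum_u \sum_v (gadj G u v)%:R * (F i u - F i v) ^+ 2
             <= B * \sum_u F i u ^+ 2) ->
  lambda R G k <= B.
Proof.
move=> k0 disj nz HE.
pose Fc : 'M[R[i]]_(k, gn G) := \matrix_(i, u) (F i u)%:C%C.
have xE (c : 'rV_k) u i : F i u != 0 -> (c *m Fc) 0 u = c 0 i * (F i u)%:C%C.
  move=> iu; rewrite mxE (bigD1 i) //= big1 ?addr0 ?mxE // => j ji; rewrite mxE.
  have [->|ju] := eqVneq (F j u) 0; first by rewrite mulr0.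
  by rewrite (disj _ _ _ ju iu) eqxx in ji.
have x0 (c : 'rV_k) u : (forall i, F i u = 0) -> (c *m Fc) 0 u = 0.
  by move=> iu; rewrite mxE big1 // => j _; rewrite mxE iu mulr0.
have Ff : row_free Fc.
  rewrite -kermx_eq0; apply/rowV0P => c /sub_kermxP cF; apply/rowP => i.
  have [u iu] := nz i; have /esym/eqP := xE c u i iu.
  by rewrite cF !mxE mulf_eq0 => /orP[/eqP //|]; rewrite (inj_eq (@complexI R) _ 0) (negbTE iu).
apply: (lambda_le_count k0 Ff) => c /=; set x := c *m Fc.
pose T i u v := `|c 0 i| ^+ 2 * ((F i u - F i v) ^+ 2)%:C%C.
have T0 i u v : 0 <= T i u v by apply: mulr_ge0; [exact: exprn_ge0 | rewrite ler0c sqr_ge0].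
have nF (z : R[i]) (f : R) : `|z * f%:C%C| ^+ 2 = `|z| ^+ 2 * (f ^+ 2)%:C%C.
  rewrite normrM exprMn [`|f%:C%C| ^+ 2]real_normK ?rmorphXn //.
  by apply/complex_realP; exists f.
have xu u : `|x 0 u| ^+ 2 = \sum_i `|c 0 i| ^+ 2 * (F i u ^+ 2)%:C%C.
  have [/existsP[i iu]|/existsPn iu] := boolP [exists i, F i u != 0].
    rewrite (xE c u i iu) (bigD1 i) //= big1 ?addr0 ?nF // => j ji.
    have [->|ju] := eqVneq (F j u) 0; first by rewrite expr0n mulr0.
    by rewrite (disj _ _ _ ju iu) eqxx in ji.
  have {}iu i : F i u = 0 by apply/eqP/negPn; apply: iu.
  rewrite x0 // normr0 expr0n big1 // => i _; by rewrite iu expr0n mulr0.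
have xuv u v : `|x 0 u - x 0 v| ^+ 2 <= 2 * \sum_i T i u v.
  have S0 (P : pred 'I_k) : 0 <= \sum_(i | P i) T i u v by rewrite sumr_ge0.
  have two1 (z : R[i]) : 0 <= z -> z <= 2 * z by move=> z0; rewrite mulr_natl mulr2n lerDl.
  have one i : x 0 u = c 0 i * (F i u)%:C%C -> x 0 v = c 0 i * (F i v)%:C%C ->
      `|x 0 u - x 0 v| ^+ 2 <= 2 * \sum_i T i u v.
    move=> -> ->; rewrite -mulrBr -rmorphB nF -/(T i u v) (bigD1 i) //=.
    by apply: le_trans (two1 _ _) _ => //; rewrite ler_wpM2l // lerDl.
  have [/existsP[i iu]|/existsPn iu] := boolP [exists i, F i u != 0]; last first.
    have {}iu i : F i u = 0 by apply/eqP/negPn; apply: iu.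
    have [/existsP[j jv]|/existsPn jv] := boolP [exists i, F i v != 0].
      by apply: (one j); rewrite ?(xE c v j jv) // x0 // iu mulr0.
    have {}jv i : F i v = 0 by apply/eqP/negPn; apply: jv.
    by rewrite !x0 // subrr normr0 expr0n mulr_ge0.
  have xui := xE c u i iu.
  have [iv|iv] := eqVneq (F i v) 0; last exact: (one i xui (xE c v i iv)).
  have [/existsP[j jv]|/existsPn jv] := boolP [exists i, F i v != 0]; last first.
    have {}jv l : F l v = 0 by apply/eqP/negPn; apply: jv.
    by apply: (one i xui); rewrite x0 // iv mulr0.
  have ji : j != i by apply: contraNneq jv => ->; rewrite iv.
  have ju : F j u = 0 by apply/eqP; apply: contraTT ji => ju; rewrite (disj _ _ _ ju iu) eqxx.
  rewrite xui (xE c v j jv) (le_trans (normC_sub_sqr _ _)) // ler_wpM2l //.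
  rewrite (bigD1 i) //= (bigD1 j) //= /T iv ju subr0 sub0r sqrrN !nF addrA lerDl.
  by apply: sumr_ge0 => l _; exact: T0.
rewrite -(ler_pMn2r (isT : 0 < 2)%N) laplacian_quadratic sum_normC_sq.
apply: (le_trans (y := \sum_u \sum_v (gadj G u v)%:R * (2 * \sum_i T i u v))).
  by apply: ler_sum => u _; apply: ler_sum => v _; apply: ler_wpM2l.
have -> : \sum_u \sum_v (gadj G u v)%:R * (2 * \sum_i T i u v) =
   (\sum_i `|c 0 i| ^+ 2 * (\sum_u \sum_v (gadj G u v)%:R * (F i u - F i v) ^+ 2)%:C%C) *+ 2.
  under [in RHS]eq_bigr do rewrite rmorph_sum mulr_sumr.
  rewrite [in RHS]exchange_big -sumrMnl; apply: eq_bigr => u _ /=.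
  under [in RHS]eq_bigr do rewrite rmorph_sum mulr_sumr.
  rewrite [in RHS]exchange_big -sumrMnl; apply: eq_bigr => v _ /=.
  rewrite mulrCA mulr_natl mulr_sumr; congr (_ *+ 2); apply: eq_bigr => i _.
  by rewrite /T mulrCA [in RHS]rmorphM /= rmorph_nat.
rewrite ler_pMn2r //.
under [in leRHS]eq_bigr do rewrite xu.
rewrite exchange_big mulr_sumr; apply: ler_sum => i _ /=.
rewrite -mulr_sumr mulrCA ler_wpM2l ?exprn_ge0 //.
by rewrite -rmorph_sum -rmorphM lecR.
Qed.

Local Close Scope sesquilinear_scope.

(** * From an excluded graph to the final bound *)

Lemma clique_minor_minor (G0 G : graph) (h : nat) :
  (gn G0 <= h)%N -> clique_minor (gadj G) h -> minor G0 G.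
Proof.
move=> G0h [B [B0 Bd Bc Bt]].
have wI (i j : 'I_(gn G0)) : i != j -> widen_ord G0h i != widen_ord G0h j.
  by apply: contra => /eqP/(congr1 val) /= ij; apply/eqP/val_inj.
exists (fun i => B (widen_ord G0h i)); split=> [i|i j ij|i|i j ij].
- exact: B0.
- exact/Bd/wI.
- by move=> x y; apply: (connP _ _ (Bc _)).
- have ne : i != j by apply: contraTneq ij => ->; rewrite girr.
  by have /touchP := Bt _ _ (wI i j ne).
Qed.

Lemma degree_le_dmax (G : graph) (v : 'I_(gn G)) : (\sum_u gadj G v u <= dmax G)%N.
Proof.
apply: leq_trans (leq_bigmax v); rewrite /deg -sum1dep_card [leqRHS]big_mkcond leq_sum //.
Qed.

Lemma natr_sqdist (R : realType) (a b : nat) :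
  (sqdist a b)%:R = (a%:R - b%:R) ^+ 2 :> R.
Proof.
rewrite /sqdist natrX; case: (leqP a b) => [ab|/ltnW ba].
  by rewrite (eqP ab) add0n natrB // -sqrrN opprB.
by rewrite (eqP ba) addn0 natrB.
Qed.

Lemma lambda_le_bumps (R : realType) (G : graph) (k P Q : nat)
    (g : 'I_k -> 'I_(gn G) -> nat) :
  (0 < k)%N -> (0 < P)%N ->
  (forall v i j, g i v != 0%N -> g j v != 0%N -> i = j) ->
  (forall i, exists v, g i v != 0%N) ->
  (forall i, P * (\sum_u \sum_v gadj G u v * sqdist (g i u) (g i v))
             <= Q * \sum_v g i v ^ 2)%N ->
  lambda R G k <= Q%:R / P%:R.
Proof.
move=> k0 P0 disj nz HE.
apply: (lambda_le_disjoint (F := fun i v => (g i v)%:R)) => // [v i j|i|i].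
- by rewrite !pnatr_eq0; apply: disj.
- by have [v iv] := nz i; exists v; rewrite pnatr_eq0.
rewrite mulrAC ler_pdivlMr ?ltr0n // mulrC.
have -> : \sum_u \sum_v (gadj G u v)%:R * ((g i u)%:R - (g i v)%:R) ^+ 2 =
    (\sum_u \sum_v gadj G u v * sqdist (g i u) (g i v))%N%:R :> R.
  rewrite natr_sum; apply: eq_bigr => u _; rewrite natr_sum; apply: eq_bigr => v _.
  by rewrite natrM natr_sqdist.
have -> : \sum_u (g i u)%:R ^+ 2 = (\sum_u g i u ^ 2)%N%:R :> R.
  by rewrite natr_sum; apply: eq_bigr => u _; rewrite natrX.
by rewrite -!natrM ler_nat HE.
Qed.

(** Point masses at [k] vertices. This crude bound settles the case where [n] is below a constant
    times [k]. *)
Lemma lambda_le_dmax (R : realType) (G : graph) (k : nat) :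
  (1 <= k <= gn G)%N -> lambda R G k <= (2 * dmax G)%N%:R.
Proof.
move=> /andP[k0 kn]; rewrite -[leRHS]divr1.
apply: (@lambda_le_bumps R G k 1 _ (fun i v => nat_of_bool (v == widen_ord kn i))) => // [v i j|i|i].
- by rewrite !eqb0 !negbK => /eqP -> /eqP/(congr1 val) /= ij; apply: val_inj.
- by exists (widen_ord kn i); rewrite eqxx.
set x := widen_ord kn i; have -> : (\sum_v (v == x) ^ 2 = 1)%N.
  by rewrite (bigD1 x) //= eqxx big1 // => v /negbTE ->.
rewrite mul1n muln1.
apply: (@leq_trans (\sum_u \sum_v ((u == x) * gadj G x v + (v == x) * gadj G x u))%N).
  apply: leq_sum => u _; apply: leq_sum => v _.
  case: (eqVneq u x) => [->|ux]; case: (eqVneq v x) => [->|vx];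
    rewrite ?girr ?muln0 ?mul1n ?muln1 ?mul0n ?addn0 //.
  by rewrite [gadj G u x]gsym.
have sumx (a : 'I_(gn G) -> nat) : (\sum_u (u == x) * a u = a x)%N.
  by rewrite (bigD1 x) //= eqxx mul1n big1 ?addn0 // => u /negbTE ->.
under eq_bigr do rewrite big_split /= -big_distrr /= sumx.
rewrite big_split /= sumx mul2n -addnn leq_add ?degree_le_dmax //.
Qed.

Theorem theorem1p2 (R : realType) (F : graph -> Prop) :
  minor_closed F -> (exists G0 : graph, ~ F G0) ->
  exists c : R, 0 < c /\
    forall (G : graph) (k : nat), F G -> (1 <= k <= nverts G)%N ->
      lambda R G k <= c * (dmax G)%:R * (k%:R / (nverts G)%:R).
Proof.
(* A clique on at least [gn G0] branch sets contains [G0] as a minor; the surplus 2 gives [1 < h]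
   even for an empty [G0]. *)
move=> Fcl [G0 G0F]; pose h := (gn G0).+2.
pose K0 := (144 * (2 ^ h.+1 + 1))%N; pose Xi := (16 * (K0 + 1) ^ 2)%N.
pose q0 := (8 * (16 * Xi * (48 * h) ^ 2))%N.
pose C0 := (8 * (16 * Xi * (48 * h * (8 * h)) ^ 2) * (64 * h) ^ 2)%N.
(* [C0] serves the case of large [n / k], the second summand turns [2 * dmax] into the required form
   when [n < 32 * h * K0 * k * q0], and the successor makes [c] positive. *)
pose c := (C0 + 2 * (32 * h * K0 * q0)).+1.
exists c%:R; split=> [|G k FG kn]; first by rewrite ltr0n.
have /andP[k0 kn'] := kn.
have n0 : (0 < nverts G)%N by apply: leq_trans kn'.
have bound (Q P : nat) : (0 < P)%N -> (Q * nverts G <= c * dmax G * k * P)%N ->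
    Q%:R / P%:R <= c%:R * (dmax G)%:R * (k%:R / (nverts G)%:R) :> R.
  move=> P0 QP; rewrite mulrA ler_pdivlMr ?ltr0n // mulrAC ler_pdivrMr ?ltr0n //.
  by rewrite -!natrM ler_nat.
have [big|small] := leqP (32 * h * K0 * k * q0) (nverts G).
  have nm : ~ clique_minor (gadj G) h.
    by move=> /clique_minor_minor mG; apply/G0F/(Fcl G) => //; apply: mG; rewrite /h ltnW.
  have big' : (32 * h * K0 * k * q0 <= #|'I_(gn G)|)%N by rewrite card_ord.
  have [g [gd gn0 gE]] := @disjoint_bumps _ (gadj G) (@gsym G) h (dmax G) isT nm
    (@degree_le_dmax G) k k0 big'.
  apply: le_trans (lambda_le_bumps R k0 n0 gd gn0 (Q := (C0 * dmax G * k)%N) _) _.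
    by move=> i; have := gE i; rewrite card_ord.
  apply: bound => //; rewrite leq_mul2r; apply/orP; right.
  by rewrite !leq_mul // /c leqW // leq_addr.
apply: le_trans (lambda_le_dmax R kn) _; have := @bound (2 * dmax G)%N 1 isT; rewrite divr1; apply.
rewrite muln1 [(2 * _)%N]mulnC -!mulnA [(c * _)%N]mulnCA leq_mul2l; apply/orP; right.
apply: (@leq_trans (2 * (32 * h * K0 * q0) * k)%N).
  by rewrite -[leqRHS]mulnA leq_mul2l /= mulnAC ltnW.
by rewrite leq_mul2r /c leqW ?orbT // leq_addl.
Qed.
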